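(* For every finite group $\Gamma$, there exist finite (uncolored) graphs $G_1$ and $G_2$ such that $\mathrm{Aut}(G_1)\cong\mathrm{Aut}(G_2)\cong\Gamma$, $\mathrm{Qut}(G_1)=\mathrm{Aut}(G_1)$ and $\mathrm{Qut}(G_2)\neq\mathrm{Aut}(G_2)$.
   Context: A graph $G=(V(G),E(G))$ is finite, undirected, without loops or parallel edges. The quantum automorphism group $\mathrm{Qut}(G)$ is the compact matrix quantum group $(C(\mathrm{Qut}(G)),u)$, where $C(\mathrm{Qut}(G))$ is the universal unital $C^*$-algebra with generators $u_{ij}$, $i,j\in V(G)$, and relations: $u_{ij}=u_{ij}^*=u_{ij}^2$ for all $i,j$; $\sum_l u_{il}=1=\sum_l u_{li}$ for all $i$; and $u_{ij}u_{kl}=0$ whenever exactly one of $(i,k)\in E(G)$, $(j,l)\in E(G)$ holds. The comultiplication is $\Delta(u_{ij})=\sum_k u_{ik}\otimes u_{kj}$. The abelianization of $C(\mathrm{Qut}(G))$ is $C(\mathrm{Aut}(G))$. One writes $\mathrm{Qut}(G)=\mathrm{Aut}(G)$ (''$G$ has no quantum symmetry'') if the classical and quantum automorphism group coincide, i.e. if $C(\mathrm{Qut}(G))$ is commutative, and $\mathrm{Qut}(G)\neq\mathrm{Aut}(G)$ (''$G$ has quantum symmetry'') otherwise. *)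

(* Defs.v *)
From mathcomp Require Import all_boot all_order all_fingroup all_algebra.
From mathcomp Require Import reals complex.
Import Order.TTheory GRing.Theory Num.Theory ComplexField.Normc.
Set Implicit Arguments.
Unset Strict Implicit.
Unset Printing Implicit Defensive.

Local Open Scope ring_scope.

Record sgraph := SGraph {
  vertex :> finType;
  edge : rel vertex;
  edge_sym : symmetric edge;
  edge_irr : irreflexive edge }.

Section GraphAut.
Variable G : sgraph.

Definition graph_aut : {set {perm G}} :=
  [set s : {perm G} | [forall x, forall y, edge (s x) (s y) == edge x y]].

Lemma group_set_graph_aut : group_set graph_aut.
Proof.
apply/group_setP; split=> [|s t].
  by rewrite inE; apply/forallP=> x; apply/forallP=> y; rewrite !perm1.
rewrite !inE => /forallP s_aut /forallP t_aut.
apply/forallP=> x; apply/forallP=> y; rewrite !permM.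
by rewrite (eqP (forallP (t_aut _) _)) (eqP (forallP (s_aut _) _)).
Qed.

Canonical graph_aut_group := Group group_set_graph_aut.

End GraphAut.

(* Unital complex C*-algebras, with a real-valued norm.  This is a plain record
   over [algType] because GRing.Algebra and NormedModule cannot be joined in the
   existing hierarchy.  [algType] forces 1 != 0, which loses nothing below: the
   relations of [magic_rel] always have the one-dimensional representation
   u i j = (i == j)%:R, so the algebra they present is nonzero. *)
Record cstarAlg (R : realType) := CstarAlg {
  cstar_sort :> algType R[i];
  star : cstar_sort -> cstar_sort;
  cnorm : cstar_sort -> R;
  starK : involutive star;
  starD : {morph star : a b / a + b};
  starZ : forall (c : R[i]) a, star (c *: a) = c^* *: star a;
  starM : forall a b, star (a * b) = star b * star a;
  cnorm_eq0 : forall a, cnorm a = 0 -> a = 0;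
  cnormD : forall a b, cnorm (a + b) <= cnorm a + cnorm b;
  cnormZ : forall (c : R[i]) a, cnorm (c *: a) = normc c * cnorm a;
  cnormM : forall a b, cnorm (a * b) <= cnorm a * cnorm b;
  cnorm_starM : forall a, cnorm (star a * a) = cnorm a ^+ 2;
  cnorm_complete : forall s : nat -> cstar_sort,
    (forall e, 0 < e -> exists N, forall m n,
       (N <= m)%N -> (N <= n)%N -> cnorm (s m - s n) < e) ->
    exists l, forall e, 0 < e -> exists N, forall n,
       (N <= n)%N -> cnorm (s n - l) < e }.

Section QuantumAut.
Variables (R : realType) (G : sgraph).

Record magic_rel (A : cstarAlg R) (u : G -> G -> A) : Prop := {
  magic_star : forall i j, star (u i j) = u i j;
  magic_idem : forall i j, u i j * u i j = u i j;
  magic_row : forall i, \sum_l u i l = 1;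
  magic_col : forall i, \sum_l u l i = 1;
  magic_edge : forall i j k l, edge i k != edge j l -> u i j * u k l = 0 }.

Record closed_star_subalg (A : cstarAlg R) (S : A -> Prop) : Prop := {
  subalg_closed : forall a,
    (forall e, 0 < e -> exists2 b, S b & cnorm (a - b) < e) -> S a;
  subalg1 : S 1;
  subalgD : forall a b, S a -> S b -> S (a + b);
  subalgZ : forall (c : R[i]) a, S a -> S (c *: a);
  subalgM : forall a b, S a -> S b -> S (a * b);
  subalg_star : forall a, S a -> S (star a) }.

(* [A], with the family [u], is the universal unital C*-algebra C(Qut(G)).
   Two such pairs are isomorphic by the *-homomorphisms of [CQut_univ]: these
   are automatically continuous, hence determined by their values on [u] by
   [CQut_gen]. *)
Record is_CQut (A : cstarAlg R) (u : G -> G -> A) : Prop := {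
  CQut_rel : magic_rel u;
  CQut_gen : forall S : A -> Prop,
    closed_star_subalg S -> (forall i j, S (u i j)) -> forall a, S a;
  CQut_univ : forall (B : cstarAlg R) (v : G -> G -> B), magic_rel v ->
    exists f : {lrmorphism A -> B},
      (forall a, f (star a) = star (f a)) /\ (forall i j, f (u i j) = v i j) }.

(* Qut(G) = Aut(G), i.e. C(Qut(G)) is commutative; the choice of the pair is
   immaterial by the uniqueness above.  Qut(G) <> Aut(G) is the negation. *)
Definition Qut_eq_Aut : Prop :=
  exists (A : cstarAlg R) (u : G -> G -> A),
    is_CQut u /\ commutative (@GRing.mul A).

End QuantumAut.

(* Main.v *)
From HB Require Import structures.
Require Import Defs.
From mathcomp Require Import all_boot all_order all_fingroup all_algebra.
From mathcomp Require Import reals complex ring lra.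
Import Order.TTheory GRing.Theory Num.Theory ComplexField.Normc.
Set Implicit Arguments.
Unset Strict Implicit.
Unset Printing Implicit Defensive.
Local Open Scope ring_scope.

(** Both graphs come from vertex-coloured graphs, for which rigidity is easy to arrange.

Colours.  Say that a magic unitary [u] preserves a colouring if [u x y = 0] whenever [x] and
[y] have different colours.  Colour refinement works for magic unitaries as it does for
automorphisms: if a colouring is preserved, so is the number of neighbours of a given colour
([preserves_count]).  Hence a vertex-coloured graph can be replaced by a graph in which
refinement recovers the colours ([decolor_preserves]): adjoin a hub, joined to all the old
vertices and to a leaf, and a clique of labels, one for each colour, whose neighbourhoods
among the old vertices are nested and distinct.

The group.  The coloured graph [frucht] is a subdivided Cayley graph of the group with respect
to all its elements: a layer of sources, a layer of targets, and for each group element [s] a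
layer of vertices of colour [s], one on each arc from [h] to [s * h].  Between two layers the
edges, if there are any, form a perfect matching, and a magic unitary is transported unchanged
along a matching ([qperm_matching]).  So the entry at [(h, l)] and [(k, l)] depends on
[h^-1 * k] only ([frucht_rigid]): a magic unitary amounts to projections indexed by the group
with sum [1].  Since these are pairwise orthogonal, the algebra of functions on the group is
universal, and it is commutative ([frucht_no_quantum_symmetry]).  Applied to permutation
matrices, the same rigidity computes the automorphism group ([frucht_graph_aut]).

Quantum symmetry.  For the second graph, a component is added which has no automorphism but a
noncommutative magic unitary.  It encodes a homogeneous linear system over the field with two
elements ([system_graph]): its automorphisms are the solutions of the system
([system_graph_asym]), whereas its magic unitaries include the operator solutions, families of
self-adjoint unitary involutions that commute within each equation ([system_magic_rel]).  The
system has one unknown for each double transposition of at least eight points, and one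
equation [s + t = s t] for each commuting pair of double transpositions whose product is a
double transposition.  Its only solution is zero ([additive_vanishes]), while the permutation
matrices are an operator solution that does not commute ([dt_op_noncomm]). *)

(** * Projections in a C*-algebra with sum one *)

Section CStarProjections.
Variables (R : realType) (A : cstarAlg R).
Implicit Types (a b p x y : A) (c : R[i]).

Lemma normc_real (r : R) : normc (r%:C)%C = `|r|.
Proof. by rewrite /normc /= expr0n addr0 sqrtr_sqr. Qed.

Lemma cnorm0 : cnorm (0 : A) = 0.
Proof. by rewrite -(scale0r (0 : A)) cnormZ normc0 mul0r. Qed.

Lemma cnormN a : cnorm (- a) = cnorm a.
Proof. by rewrite -scaleN1r cnormZ normcN normc1 mul1r. Qed.

Lemma cnorm_ge0 a : 0 <= cnorm a.
Proof.
have := cnormD a (- a); rewrite subrr cnorm0 cnormN -mulr2n.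
by rewrite pmulrn_lge0.
Qed.

Lemma cnormB a b : cnorm (a - b) <= cnorm a + cnorm b.
Proof. by rewrite -(cnormN b); apply: cnormD. Qed.

Lemma star1 : star (1 : A) = 1.
Proof.
have := starM (star 1) (1 : A); rewrite mulr1 starK mulr1 => <- //.
Qed.

Lemma star0 : star (0 : A) = 0.
Proof. by rewrite -(scale0r (0 : A)) starZ conjC0 !scale0r. Qed.

Lemma starN a : star (- a) = - star a.
Proof. by rewrite -scaleN1r starZ rmorphN rmorph1 scaleN1r. Qed.

Lemma star_sum (I : finType) (F : I -> A) :
  star (\sum_i F i) = \sum_i star (F i).
Proof. by apply: (big_morph _ (@starD _ A) star0). Qed.

Lemma cnorm_sa a : star a = a -> cnorm (a * a) = cnorm a ^+ 2.
Proof. by move=> {1}<-; apply: cnorm_starM. Qed.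

Lemma starM_eq0 a : star a * a = 0 -> a = 0.
Proof.
move=> h; apply: cnorm_eq0; apply/eqP.
by rewrite -sqrf_eq0 -cnorm_starM h cnorm0.
Qed.

Lemma cnorm_proj_le1 p : star p = p -> p * p = p -> cnorm p <= 1.
Proof.
move=> sp pp; have := cnorm_sa sp; rewrite pp => h.
have := cnorm_ge0 p; nra.
Qed.

Lemma cnormM_le1 a b : cnorm a <= 1 -> cnorm b <= 1 -> cnorm (a * b) <= 1.
Proof.
have := cnormM a b; have := cnorm_ge0 a; have := cnorm_ge0 b; nra.
Qed.

Lemma cnormX3_le1 a : cnorm a <= 1 -> cnorm (a * a * a) <= 1.
Proof. by move=> a1; rewrite !cnormM_le1. Qed.

Lemma cnormZr (r : R) a : cnorm (r%:C%C *: a) = `|r| * cnorm a.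
Proof. by rewrite cnormZ normc_real. Qed.

(** In the corner [p A p], whose unit is [p]: both [p + y] and [p - y] are contractions.  The
lemmas below show that only [y = 0] is possible, that is, [p] is an extreme point of the unit
ball of its corner. *)
Definition corner_contractive p y :=
  [/\ star y = y, p * y = y, y * p = y, cnorm (p + y) <= 1 & cnorm (p - y) <= 1].

Section Corner.
Variable p : A.
Hypotheses (p_sa : star p = p) (p_idem : p * p = p).

(** Evaluation of polynomials at [y] in the corner of [p], with constant term read as a multiple
of [p].  It turns identities between products in the corner into polynomial identities. *)
Definition corner_ev y (q : {poly R[i]}) : A := p * horner_alg y q.

Lemma corner_evD y q1 q2 : corner_ev y (q1 + q2) = corner_ev y q1 + corner_ev y q2.
Proof. by rewrite /corner_ev rmorphD mulrDr. Qed.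

Lemma corner_evC y c q : corner_ev y (c%:P * q) = c *: corner_ev y q.
Proof. by rewrite /corner_ev rmorphM /= horner_algC mulr_algl scalerAr. Qed.

Lemma corner_ev1 y : corner_ev y 1 = p.
Proof. by rewrite /corner_ev rmorph1 mulr1. Qed.

Lemma corner_evX y : p * y = y -> corner_ev y 'X = y.
Proof. by rewrite /corner_ev horner_algX. Qed.

Lemma corner_evP y : p * y = y -> p + y = corner_ev y (1 + 'X).
Proof. by move=> py; rewrite corner_evD corner_ev1 corner_evX. Qed.

Lemma corner_evN y : p * y = y -> p - y = corner_ev y (1 - 'X).
Proof.
move=> py; have -> : - 'X = (-1)%:P * 'X :> {poly R[i]} by rewrite polyCN mulN1r.
by rewrite corner_evD corner_ev1 corner_evC corner_evX // scaleN1r.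
Qed.

Lemma corner_evM y q1 q2 : p * y = y -> y * p = y ->
  corner_ev y (q1 * q2) = corner_ev y q1 * corner_ev y q2.
Proof.
move=> py yp; have pC q : p * horner_alg y q = horner_alg y q * p.
  elim/poly_ind: q => [|q c IH]; first by rewrite rmorph0 mulr0 mul0r.
  rewrite rmorphD rmorphM /= horner_algX horner_algC.
  rewrite mulrDr mulrDl mulrA IH -[_ * p * y]mulrA py -[_ * y * p]mulrA yp.
  by rewrite -scalerAr -scalerAl mulr1 mul1r.
by rewrite /corner_ev rmorphM /= [RHS]mulrA -(mulrA p) -pC !mulrA p_idem.
Qed.

(** The C*-identity makes the imaginary directions contractive as well: the square of the norm of
[p + i y] is the norm of [p + y ^ 2], and [p + y ^ 2] is the mean of [(p + y) ^ 2] and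
[(p - y) ^ 2]. *)
Lemma corner_contractive_i y (s : bool) : corner_contractive p y ->
  cnorm (p + ((-1) ^+ s * 'i%C) *: y) <= 1.
Proof.
move=> [ys py yp yp1 yn1]; set c := _ * _.
have cc : c * c = -1 by rewrite -expr2 exprMn sqr_i sqrr_sign mul1r.
have cJ : c^* = - c.
  rewrite rmorphM /= rmorph_sign /c -mulrN; congr (_ * _).
  by apply/eqP; rewrite eq_complex /= oppr0 !eqxx.
have eC d : p + d *: y = corner_ev y (1 + d%:P * 'X).
  by rewrite corner_evD corner_ev1 corner_evC corner_evX.
have e1 : star (p + c *: y) * (p + c *: y) = corner_ev y (1 + 'X * 'X).
  rewrite starD starZ p_sa ys cJ !eC -corner_evM //; congr corner_ev.
  rewrite polyCN; have := congr1 polyC cc; rewrite polyCM polyCN => cc'.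
  by ring: cc'.
have e2 : 2%:C%C *: corner_ev y (1 + 'X * 'X) = (p + y) * (p + y) + (p - y) * (p - y).
  rewrite corner_evP // corner_evN // -!corner_evM // -corner_evD -corner_evC.
  by congr corner_ev; rewrite rmorphMn /= rmorph1; ring.
have h : cnorm (corner_ev y (1 + 'X * 'X)) <= 1.
  have := cnormZr 2 (corner_ev y (1 + 'X * 'X)); rewrite e2.
  have := cnormD ((p + y) * (p + y)) ((p - y) * (p - y)).
  have := cnormM (p + y) (p + y); have := cnormM (p - y) (p - y).
  have := cnorm_ge0 (p + y); have := cnorm_ge0 (p - y).
  rewrite ger0_norm //.
  nra.
have := cnorm_starM (p + c *: y); rewrite e1 => h2.
have := cnorm_ge0 (p + c *: y); nra.
Qed.

Lemma corner_contractiveN y : corner_contractive p y -> corner_contractive p (- y).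
Proof.
by move=> [ys py yp yp1 yn1]; split; rewrite ?starN ?mulrN ?mulNr ?ys ?py ?yp ?opprK.
Qed.

Lemma corner_contractive_bound y : corner_contractive p y -> cnorm y <= 2^-1.
Proof.
move=> [ys py yp yp1 yn1].
have e2 : 4%:C%C *: y = (p + y) * (p + y) - (p - y) * (p - y).
  rewrite corner_evP // corner_evN // -!corner_evM // -[- corner_ev _ _]scaleN1r.
  rewrite -corner_evC -corner_evD -{1}(corner_evX py) -corner_evC.
  by congr corner_ev; rewrite rmorphMn /= rmorph1 polyCN; ring.
have := cnormZr 4 y; rewrite e2 ger0_norm //.
have := cnormB ((p + y) * (p + y)) ((p - y) * (p - y)).
have := cnormM (p + y) (p + y); have := cnormM (p - y) (p - y).
have := cnorm_ge0 (p + y); have := cnorm_ge0 (p - y).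
nra.
Qed.

(** A convex combination of third powers of [p + y], [p + i y] and [p - i y], with weights [1 / 2],
[1 / 4] and [1 / 4], equals [p + amplify y]: the square terms cancel.  So [amplify] preserves the
contractive elements, and it enlarges the small ones. *)
Definition amplify y := (2^-1)%:C%C *: (3%:C%C *: y + y * y * y).

Lemma corner_contractive_amplify_norm y : corner_contractive p y -> cnorm (p + amplify y) <= 1.
Proof.
move=> yS; have [ys py yp yp1 yn1] := yS.
have hi := corner_contractive_i true yS; have hj := corner_contractive_i false yS.
have {yp1} := cnormX3_le1 yp1; have {hi} := cnormX3_le1 hi; have {hj} := cnormX3_le1 hj.
have eC d : p + d *: y = corner_ev y (1 + d%:P * 'X).
  by rewrite corner_evD corner_ev1 corner_evC corner_evX.
set a := (_ * _ * _) => a1; set b := (_ * _ * _) => b1; set d := (_ * _ * _) => d1.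
have -> : p + amplify y =
   (2^-1)%:C%C *: d + (4^-1)%:C%C *: (a + b).
  rewrite /amplify /a /b /d !eC (corner_evP py) -!corner_evM // -{1 2 3 4}(corner_evX py).
  rewrite -!corner_evM // -!corner_evC -!corner_evD -!corner_evC -corner_evD.
  rewrite -{1}(corner_ev1 y) -corner_evD; congr corner_ev.
  set t := 'i%C; have tt : t * t = -1 by rewrite -expr2 sqr_i.
  rewrite !rmorphM /= !rmorph_sign /= expr1 expr0 mul1r mulN1r.
  have := congr1 polyC tt; rewrite polyCM polyCN /=.
  set T := t%:P => TT.
  have -> : (2^-1)%:C%C = 2 * 4^-1 :> R[i] by rewrite fmorphV rmorph_nat; field.
  have -> : (4^-1)%:C%C = 4^-1 :> R[i] by rewrite fmorphV rmorph_nat.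
  have := congr1 polyC (mulfV (_ : 4 != 0 :> R[i])); rewrite pnatr_eq0 => /(_ isT).
  have -> : 3%:C%C = 3 :> R[i] by rewrite rmorph_nat.
  rewrite !polyCM !rmorph_nat polyC1; set q := (4^-1)%:P => q4.
  by ring: TT q4.
apply: le_trans (cnormD _ _) _; rewrite !cnormZr !ger0_norm ?invr_ge0 //.
have := cnormD a b; lra.
Qed.

Lemma corner_contractive_amplify y : corner_contractive p y -> corner_contractive p (amplify y).
Proof.
move=> yS; have [ys py yp _ _] := yS.
have amplifyN : p - amplify y = p + amplify (- y).
  by rewrite /amplify -scalerN opprD !mulrNN mulrN scalerN.
have conjR (r : R) : (r%:C%C)^* = r%:C%C.
  by apply/eqP; rewrite eq_complex /= oppr0 !eqxx.
split; last 2 first.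
- exact: corner_contractive_amplify_norm.
- by rewrite amplifyN; apply/corner_contractive_amplify_norm/corner_contractiveN.
- by rewrite /amplify starZ starD starZ !starM ys !conjR mulrA.
- by rewrite /amplify -scalerAr mulrDr -scalerAr !mulrA !py.
by rewrite /amplify -scalerAl mulrDl -scalerAl -!mulrA !yp.
Qed.

Lemma corner_contractive_amplify_ge y : corner_contractive p y ->
  5 / 4 * cnorm y <= cnorm (amplify y).
Proof.
move=> yS; have := corner_contractive_bound yS; have := cnorm_ge0 y.
rewrite /amplify cnormZr ger0_norm ?invr_ge0 //.
have := cnormB (3%:C%C *: y + y * y * y) (y * y * y).
rewrite addrK cnormZr ger0_norm //.
have := cnormM (y * y) y; have := cnormM y y.
have := cnorm_ge0 (y * y).
set c := cnorm y; nra.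
Qed.

(** Iterating [amplify] multiplies a nonzero norm by at least [5 / 4] each time, whereas contractive
elements have norm at most [1 / 2]. *)
Lemma corner_contractive_eq0 y : corner_contractive p y -> y = 0.
Proof.
move=> yS; apply/cnorm_eq0/eqP; rewrite eq_le cnorm_ge0 andbT leNgt.
apply/negP => y0.
have bnd k : (1 + k%:R / 4) * cnorm y <= 2^-1.
  have [z zS] : exists2 z, corner_contractive p z & (1 + k%:R / 4) * cnorm y <= cnorm z.
    elim: k => [|k [z zS IH]]; first by exists y => //; rewrite mul0r addr0 mul1r.
    exists (amplify z); first exact: corner_contractive_amplify.
    apply: le_trans (corner_contractive_amplify_ge zS).
    have : 0 <= k%:R :> R by []. rewrite -natr1; nra.
  by move/le_trans; apply; apply: corner_contractive_bound.
have := bnd (Num.bound (4 / cnorm y)).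
have := archi_boundP (_ : 0 <= 4 / cnorm y).
rewrite divr_ge0 ?cnorm_ge0 // => /(_ isT); rewrite ltr_pdivrMr //.
set b := _%:R; nra.
Qed.

End Corner.

(** Compress by [p = P j].  Each [x i = p * P i * p] satisfies [norm (p - x i) <= 1], and the [x i]
with [i != j] sum to zero, so [x k] is minus the sum of the others.  Averaging then shows that a
positive multiple of [x k] is contractive on both sides of [p], hence zero, and
[x k = star (P k * p) * (P k * p)]. *)
Lemma projection_orth (I : finType) (P : I -> A) :
    (forall i, star (P i) = P i) -> (forall i, P i * P i = P i) ->
    \sum_i P i = 1 ->
  forall j k, j != k -> P j * P k = 0.
Proof.
move=> Ps Pi P1 j k jk; set p := P j; have kj : k != j by rewrite eq_sym.
pose x i := p * P i * p.
have xs i : star (x i) = x i by rewrite /x !starM !Ps mulrA.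
have px i : p * x i = x i by rewrite /x !mulrA Pi.
have xp i : x i * p = x i by rewrite /x -!mulrA Pi.
have p1 : cnorm p <= 1 := cnorm_proj_le1 (Ps j) (Pi j).
have x1 i : cnorm (p - x i) <= 1.
  have -> : p - x i = p * (1 - P i) * p by rewrite mulrBr mulrBl mulr1 Pi.
  have q1 : cnorm (1 - P i) <= 1.
    apply: cnorm_proj_le1; first by rewrite starD starN star1 Ps.
    by rewrite mulrBl mulrBr !mulr1 !mul1r mulrBr mulr1 Pi subrr subr0.
  exact: cnormM_le1 (cnormM_le1 p1 q1) p1.
(* The term with index [j] already contributes [p]. *)
have x_sum : \sum_(i | i != j) x i = 0.
  have : p * (\sum_i P i) * p = p by rewrite P1 mulr1 Pi.
  rewrite (bigD1 j) //= mulrDr mulrDl !Pi mulr_sumr mulr_suml => h.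
  by apply: (addrI p); rewrite addr0.
pose m := #|[pred i | i != j]|.
have m1 : (0 < m)%N by apply/card_gt0P; exists k; rewrite inE eq_sym.
have m0 : 0 < m%:R :> R by rewrite ltr0n.
have xk : cnorm (p + (m%:R^-1)%:C%C *: x k) <= 1.
  have -> : p + (m%:R^-1)%:C%C *: x k =
     (m%:R^-1)%:C%C *: (\sum_(i | (i != j) && (i != k)) (p - x i) + p).
    have e : \sum_(i | (i != j) && (i != k)) (p - x i) + p = p *+ m + x k.
      have -> : p *+ m = p + \sum_(i | (i != j) && (i != k)) p.
        by rewrite /m -sumr_const (bigD1 k kj).
      have -> : x k = - \sum_(i | (i != j) && (i != k)) x i.
        by move/eqP: x_sum; rewrite (bigD1 k kj) addr_eq0 => /eqP.
      by rewrite sumrB addrC addrA.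
    rewrite e scalerDr -scaler_nat scalerA fmorphV rmorph_nat mulVf ?scale1r //.
    by rewrite pnatr_eq0 -lt0n.
  rewrite cnormZr ger0_norm ?invr_ge0 ?ler0n // mulrC ler_pdivrMr // mul1r.
  apply: le_trans (cnormD _ _) _.
  have -> : m%:R = (\sum_(i | (i != j) && (i != k)) 1) + 1 :> R.
    rewrite sumr_const natr1 /m; congr _%:R.
    rewrite [LHS](cardD1 k) inE kj add1n; congr S; apply: eq_card => i.
    by rewrite !unfold_in /= andbC.
  apply: lerD; last exact: p1.
  elim/big_rec2: _ => [|i a b _ ab]; first by rewrite cnorm0.
  by apply: le_trans (cnormD _ _) _; apply: lerD.
have yS : corner_contractive p ((m%:R^-1)%:C%C *: x k).
  split => //.
  - rewrite starZ xs; congr (_ *: _).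
    by apply/eqP; rewrite eq_complex /= oppr0 !eqxx.
  - by rewrite -scalerAr px.
  - by rewrite -scalerAl xp.
  set t := m%:R^-1; have t0 : 0 <= t by rewrite invr_ge0 ler0n.
  have t1 : t <= 1 by rewrite invf_le1 // ler1n.
  have -> : p - t%:C%C *: x k = t%:C%C *: (p - x k) + (1 - t)%:C%C *: p.
    rewrite scalerBr rmorphB rmorph1 scalerBl scale1r.
    by rewrite [RHS]addrC addrA subrK.
  apply: le_trans (cnormD _ _) _; rewrite !cnormZr !ger0_norm ?subr_ge0 //.
  have := x1 k.
  nra.
have := corner_contractive_eq0 (Ps j) (Pi j) yS => /eqP.
rewrite scaler_eq0 fmorphV invr_eq0 rmorph_nat pnatr_eq0 -leqn0 leqNgt m1 /= => /eqP xk0.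
have kj0 : P k * p = 0 by apply: starM_eq0; rewrite starM !Ps mulrA -(mulrA p) Pi.
by rewrite -[LHS]starK starM !Ps kj0 star0.
Qed.

End CStarProjections.

(** * Quantum permutations and colour refinement *)

(** The algebraic part of a magic unitary, over any algebra: row and column orthogonality replace
the involution.  It covers magic unitaries in C*-algebras and permutation matrices over the
rationals alike. *)
Record qperm (V : finType) (e : rel V) (K : numFieldType) (A : algType K)
    (u : V -> V -> A) : Prop := {
  qperm_row : forall i, \sum_l u i l = 1;
  qperm_col : forall i, \sum_l u l i = 1;
  qperm_row_orth : forall i j l, j != l -> u i j * u i l = 0;
  qperm_col_orth : forall i j l, j != l -> u j i * u l i = 0;
  qperm_edge : forall i j k l, e i k != e j l -> u i j * u k l = 0 }.

Lemma magic_rel_qperm (R : realType) (G : sgraph) (A : cstarAlg R)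
  (u : G -> G -> A) : magic_rel u -> qperm (@edge G) u.
Proof.
case=> us ui ur uc ue; split => // i j l jl.
  by apply: (projection_orth _ _ (ur i)).
by apply: (projection_orth (P := u^~ i) _ _ (uc i)).
Qed.

Lemma perm_qperm (G : sgraph) (s : {perm G}) : s \in graph_aut G ->
  qperm (A := rat^o) (@edge G) (fun x y => (s x == y)%:R).
Proof.
rewrite inE => /forallP sG; split=> [i|i|i j l jl|i j l jl|i j k l].
- rewrite (bigD1 (s i)) //= eqxx big1 ?addr0 // => l; rewrite eq_sym => /negPf.
  by move->.
- rewrite (bigD1 (s^-1 i)%g) //= permKV eqxx big1 ?addr0 // => l.
  by rewrite -(inj_eq (@perm_inj _ s)) permKV => /negPf ->.
- by case: eqP => [->|]; rewrite ?(negPf jl) ?mulr0 ?mul0r.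
- case: eqP => [<-|]; rewrite ?mul0r // eq_sym (inj_eq (@perm_inj _ s)).
  by rewrite (negPf jl) mulr0.
have [<-|_] := eqVneq (s i) j; last by rewrite mul0r.
have [<-|_] := eqVneq (s k) l; last by rewrite mulr0.
by rewrite (eqP (forallP (sG i) k)) eqxx.
Qed.

Section Refinement.
Variables (V : finType) (e : rel V) (K : numFieldType) (A : algType K).
Variable u : V -> V -> A.
Hypothesis uq : qperm e u.

Definition preserves (T : eqType) (phi : V -> T) :=
  forall i j, phi i != phi j -> u i j = 0.

Lemma preserves_pair (T S : eqType) (phi : V -> T) (psi : V -> S) :
  preserves phi -> preserves psi -> preserves (fun i => (phi i, psi i)).
Proof. by move=> hphi hpsi i j; rewrite xpair_eqE negb_and => /orP[/hphi|/hpsi]. Qed.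

Lemma preserves_comp (T S : eqType) (phi : V -> T) (f : T -> S) :
  preserves phi -> preserves (f \o phi).
Proof. by move=> hphi i j /= ne; apply: hphi; apply: contra ne => /eqP ->. Qed.

Lemma preserves_sub (T S : eqType) (phi : V -> T) (psi : V -> S) :
  (forall i j, phi i = phi j -> psi i = psi j) ->
  preserves phi -> preserves psi.
Proof. by move=> sub h i j ne; apply: h; apply: contra ne => /eqP/sub ->. Qed.

(** Multiply [u i j] by the row sums to count the neighbours of [i] among the first indices [m], or
by the column sums to count the neighbours of [j] among the second indices [n].  The products
[u i j * u m n] that survive have [e i m = e j n] and [phi m = phi n], so both counts agree. *)
Lemma preserves_count (T : eqType) (phi : V -> T) (P : pred T) :
  preserves phi -> preserves (fun i => #|[pred m | e i m && P (phi m)]|).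
Proof.
move=> hphi i j; set N : V -> nat := fun i => #|[pred m | e i m && P (phi m)]|.
rewrite -/(N i) -/(N j) => ne.
have countl : (N i)%:R *: u i j = \sum_m \sum_n (e i m && P (phi m))%:R *: (u i j * u m n).
  rewrite /N -sum1_card natr_sum scaler_suml big_mkcond; apply: eq_bigr => m _.
  rewrite inE -scaler_sumr -mulr_sumr (qperm_row uq) mulr1.
  by case: ifP => _; rewrite ?scale1r ?scale0r.
have countr : (N j)%:R *: u i j = \sum_m \sum_n (e j n && P (phi n))%:R *: (u i j * u m n).
  rewrite exchange_big /N -sum1_card natr_sum scaler_suml big_mkcond /=; apply: eq_bigr => m _.
  rewrite inE -scaler_sumr -mulr_sumr (qperm_col uq) mulr1.
  by case: ifP => _; rewrite ?scale1r ?scale0r.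
have /eqP : (N i)%:R *: u i j = (N j)%:R *: u i j.
  rewrite countl countr; apply: eq_bigr => m _; apply: eq_bigr => n _.
  have [pmn|/hphi ->] := eqVneq (phi m) (phi n); last by rewrite mulr0 !scaler0.
  have [->|/(qperm_edge uq) ->] := eqVneq (e i m) (e j n); last by rewrite !scaler0.
  by rewrite pmn.
by rewrite -subr_eq0 -scalerBl scaler_eq0 subr_eq0 eqr_nat (negPf ne) => /eqP.
Qed.

Lemma preserves_exists (T : eqType) (phi : V -> T) (P : pred T) :
  preserves phi -> preserves (fun i => [exists m, e i m && P (phi m)]).
Proof.
move=> hphi; have := preserves_comp (f := fun n => n != 0%N) (preserves_count (P := P) hphi).
apply: preserves_sub => i j.
have E k : [exists m, e k m && P (phi m)] = (#|[pred m | e k m && P (phi m)]| != 0%N).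
  by rewrite -[RHS]lt0n; apply/existsP/card_gt0P => -[m]; exists m.
by rewrite !E.
Qed.

(** Expanding [u x y] by the row of [x'] leaves only [u x y * u x' y'], because [y'] is the only
neighbour of [y] of the right colour; expanding [u x' y'] by the row of [x] leaves the same
product. *)
Lemma qperm_matching (T : eqType) (phi : V -> T) x x' y y' :
    preserves phi -> e x x' ->
    (forall n, phi n = phi x' -> e y n -> n = y') ->
    (forall n, phi n = phi x -> e n y' -> n = y) ->
  u x y = u x' y'.
Proof.
move=> hphi exx yy' y'y.
have left_ : u x y = u x y * u x' y'.
  rewrite -[LHS]mulr1 -(qperm_row uq x') mulr_sumr (bigD1 y') //= big1 ?addr0 //.
  move=> n ny; have [pn|/hphi ->] := eqVneq (phi x') (phi n); last by rewrite mulr0.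
  rewrite (qperm_edge uq) // exx; apply/eqP => /esym eyn.
  by rewrite (yy' n) ?eqxx in ny.
rewrite left_ -[RHS]mul1r -(qperm_row uq x) mulr_suml (bigD1 y) //= big1 ?addr0 //.
move=> n ny; have [pn|/hphi ->] := eqVneq (phi x) (phi n); last by rewrite mul0r.
rewrite (qperm_edge uq) // exx; apply/eqP => /esym eyn.
by rewrite (y'y n) ?eqxx in ny.
Qed.

End Refinement.

(** * From vertex-coloured graphs to graphs *)

Section Decolor.
Variables (V T : finType) (e : rel V) (c : V -> T).

Definition rk (t : T) : nat := enum_rank t.

Lemma rk_inj : injective rk.
Proof. by move=> t t' /ord_inj /enum_rank_inj. Qed.

Definition dvert : finType := (V + (T + bool))%type.
Notation label t := (inr (inl t) : dvert).
Notation hub := (inr (inr true) : dvert).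
Notation leaf := (inr (inr false) : dvert).

(** In [bool], [true] is the hub and [false] the leaf.  The leaf makes the hub recognizable, the hub
makes [V] recognizable, and the nested neighbourhoods of the labels encode the colours. *)
Definition dedge : rel dvert := fun x y =>
  match x, y with
  | inl v, inl w => e v w
  | inl v, inr (inl t) | inr (inl t), inl v => (rk (c v) <= rk t)%N
  | inl v, inr (inr b) | inr (inr b), inl v => b
  | inr (inl t), inr (inl t') => t != t'
  | inr (inr b), inr (inr b') => b != b'
  | _, _ => false
  end.

Definition dcolor (x : dvert) : T + (T + bool) :=
  match x with inl v => inl (c v) | inr w => inr w end.

Lemma dedge_sym : symmetric e -> symmetric dedge.
Proof. by move=> es [v|[t|b]] [w|[t'|b']] //=; rewrite eq_sym. Qed.

Lemma dedge_irr : irreflexive e -> irreflexive dedge.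
Proof. by move=> ei [v|[t|b]] //=; rewrite eqxx. Qed.

(** Adjacency depends on the colours only, except between two old vertices. *)
Lemma dedge_color x y x' y' : dcolor x = dcolor x' -> dcolor y = dcolor y' ->
  (forall v w v' w', x = inl v -> y = inl w -> x' = inl v' -> y' = inl w' -> e v w = e v' w') ->
  dedge x y = dedge x' y'.
Proof.
move=> xx' yy' h; case: x x' y y' xx' yy' h => [v|x] [v'|x'] // [w|y] [w'|y'] //.
- by move=> _ _ h; apply: h.
- by case=> cv [->] _; case: y' => [t|b] //=; rewrite cv.
- by case=> -> [cw] _; case: x' => [t|b] //=; rewrite cw.
by case=> -> [->].
Qed.

Section Rigid.
Variables (K : numFieldType) (A : algType K) (u : dvert -> dvert -> A).
Hypotheses (uq : qperm dedge u) (c_surj : forall t, exists v, c v = t).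
Hypothesis T2 : (1 < #|T|)%N.

Let kind (x : dvert) : nat :=
  match x with inl _ => 0 | inr (inl _) => 1 | inr (inr b) => 2 + b end.

(** The leaf is the only vertex of degree one; every other vertex has two explicit neighbours. *)
Let deg1 x : (#|[pred m | dedge x m && true]| == 1%N) = (x == leaf).
Proof.
have two m m' : m != m' -> dedge x m -> dedge x m' ->
    (#|[pred m | dedge x m && true]| == 1%N) = false.
  move=> mm' xm xm'; apply/negbTE; rewrite neq_ltn; apply/orP; right.
  apply: (@leq_trans #|pred2 m m'|); first by rewrite card2 mm'.
  by apply/subset_leq_card/subsetP => k /pred2P[]->; rewrite inE ?xm ?xm'.
have /card_gt0P[t0 _] : (0 < #|T|)%N by apply: ltnW.
have [v0 _] := c_surj t0.
case: x two => [v|[t|[]]] two.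
- by rewrite (two hub (label (c v))) //=.
- have [t' tt'] : exists t', t' != t.
    apply/existsP; rewrite -[[exists _, _]]negbK negb_exists; apply: contraL T2.
    move=> /forallP h; rewrite -leqNgt -(card1 t); apply/subset_leq_card/subsetP => k _.
    by have := h k; rewrite negbK.
  have [v vt] := c_surj t.
  by rewrite (two (inl v) (label t')) //= ?vt // eq_sym.
- by rewrite (two (inl v0) leaf).
rewrite eqxx; apply/eqP; rewrite -(card1 hub); apply: eq_card => -[v|[t|[]]] //.
Qed.

Let pres_leaf : preserves u (fun x => x == leaf).
Proof.
have h := preserves_count uq (phi := fun=> tt) (P := fun=> true) (fun _ _ => _).
apply: preserves_sub (h _) => [x y eqd|i j]; last by rewrite eqxx.
by rewrite -!deg1 eqd.
Qed.

Let pres_hub : preserves u (fun x => x == hub).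
Proof.
apply: preserves_sub (preserves_exists uq (P := id) pres_leaf) => x y.
have E z : [exists m, dedge z m && (m == leaf)] = (z == hub).
  apply/existsP/eqP => [[m /andP[zm /eqP mE]]|->]; last by exists leaf.
  by move: zm; rewrite mE; case: z => [v|[t|[]]].
by rewrite !E.
Qed.

Let pres_spokes : preserves u (fun x => dedge x hub).
Proof.
apply: preserves_sub (preserves_exists uq (P := id) pres_hub) => x y.
have E z : [exists m, dedge z m && (m == hub)] = dedge z hub.
  apply/existsP/idP => [[m /andP[zm /eqP mE]]|zh]; first by rewrite -mE.
  by exists hub; rewrite zh eqxx.
by rewrite !E.
Qed.

Let pres_kind : preserves u kind.
Proof.
have := preserves_pair (preserves_pair pres_leaf pres_hub) pres_spokes.
by apply: preserves_sub => -[v|[t|[]]] [w|[t'|[]]].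
Qed.

Let count k x := #|[pred m | dedge x m && pred1 k (kind m)]|.

Let count_lt k x y : (forall m, kind m = k -> dedge x m -> dedge y m) ->
  (exists m, [/\ kind m = k, dedge y m & ~~ dedge x m]) -> (count k x < count k y)%N.
Proof.
move=> sub [m [mk ym xm]]; apply/proper_card/properP; split.
  by apply/subsetP => n; rewrite !inE => /andP[xn /eqP nk]; rewrite (sub n) // nk /=.
by exists m; rewrite !inE ?ym ?(negPf xm) // mk /=.
Qed.

(** Refinement separates in turn the leaf, the hub and the old vertices.  Old vertices are then
told apart by their number of adjacent labels and labels by their number of adjacent old
vertices, because the neighbourhoods of the labels form a strictly increasing chain. *)
Theorem decolor_preserves : preserves u dcolor.
Proof.
have := preserves_pair pres_kind (preserves_pair
  (preserves_count uq (P := pred1 0%N) pres_kind)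
  (preserves_count uq (P := pred1 1%N) pres_kind)).
apply: preserves_sub => x y [kxy]; rewrite -!/(count _ _).
have labels v w : (rk (c v) < rk (c w))%N -> (count 1 (inl w) < count 1 (inl v))%N.
  move=> vw; apply: count_lt => [[v'|[t|b]] //= _|].
    exact: leq_trans (ltnW vw).
  by exists (label (c v)); split; rewrite //= -ltnNge.
have verts t t' : (rk t < rk t')%N -> (count 0 (label t) < count 0 (label t'))%N.
  move=> tt'; apply: count_lt => [[v'|[s|b]] //= _ /leq_trans|].
    by apply; apply: ltnW.
  by have [v vt'] := c_surj t'; exists (inl v); split; rewrite //= vt' // -ltnNge.
case: x y kxy => [v|[t|b]] [w|[t'|b']] //= kxy.
- move=> _ n1; have [lt|lt|/rk_inj -> //] := ltngtP (rk (c v)) (rk (c w)).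
    by have := labels _ _ lt; rewrite n1 ltnn.
  by have := labels _ _ lt; rewrite n1 ltnn.
- move=> n0 _; have [lt|lt|/rk_inj -> //] := ltngtP (rk t) (rk t').
    by have := verts _ _ lt; rewrite n0 ltnn.
  by have := verts _ _ lt; rewrite n0 ltnn.
by case: b b' kxy => [] [].
Qed.

End Rigid.
End Decolor.

Definition decolor (V : sgraph) (T : finType) (c : V -> T) : sgraph :=
  SGraph (dedge_sym c (@edge_sym V)) (dedge_irr c (@edge_irr V)).

(** * A subdivided Cayley graph *)

Section Union.
Variables V W : sgraph.

Definition sum_edge : rel (V + W) := fun x y =>
  match x, y with
  | inl v, inl v' => edge v v'
  | inr w, inr w' => edge w w'
  | _, _ => false
  end.

Lemma sum_edge_sym : symmetric sum_edge.
Proof. by move=> [v|w] [v'|w'] //=; apply: edge_sym. Qed.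

Lemma sum_edge_irr : irreflexive sum_edge.
Proof. by move=> [v|w] /=; apply: edge_irr. Qed.

Definition disjoint_union : sgraph := SGraph sum_edge_sym sum_edge_irr.

End Union.

Section Frucht.
Variable gT : finGroupType.

(** The layers are [inr false] for the sources of arcs, [inr true] for their targets and [inl s] for
the midpoints of the arcs from [h] to [s * h].  Right multiplication acts on all layers. *)
Definition arc (x y : gT * (gT + bool)) :=
  match x.2, y.2 with
  | inl s, inr b => y.1 == (if b then s * x.1 else x.1)%g
  | _, _ => false
  end.

Definition frucht_edge : rel (gT * (gT + bool)) := fun x y => arc x y || arc y x.

Lemma frucht_edge_sym : symmetric frucht_edge.
Proof. by move=> x y; rewrite /frucht_edge orbC. Qed.

Lemma frucht_edge_irr : irreflexive frucht_edge.
Proof. by case=> h [s|b]. Qed.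

Definition frucht : sgraph := SGraph frucht_edge_sym frucht_edge_irr.

Variables (X : sgraph) (TX : finType) (cX : X -> TX).

Definition layer_color (x : disjoint_union X frucht) : TX + (gT + bool) :=
  match x with inl a => inl (cX a) | inr hl => inr hl.2 end.

(** The component [X] is empty for the graph without quantum symmetry. *)
Definition frucht_graph : sgraph := decolor layer_color.

Definition gvert (h : gT) (l : gT + bool) : frucht_graph := inl (inr (h, l)).

Definition xvert (a : X) : frucht_graph := inl (inl a).

Hypothesis cX_surj : forall t, exists a, cX a = t.

Lemma layer_color_surj t : exists v, layer_color v = t.
Proof.
case: t => [t|l]; last by exists (inr (1%g, l)).
by have [a <-] := cX_surj t; exists (inl a).
Qed.

Lemma layer_colors_gt1 : (1 < #|{: TX + (gT + bool)}|)%N.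
Proof. by rewrite !card_sum card_bool addnA addn2. Qed.

Section Rigid.
Variables (K : numFieldType) (A : algType K).
Variable u : frucht_graph -> frucht_graph -> A.
Hypothesis uq : qperm (@edge frucht_graph) u.

Lemma frucht_graph_preserves : preserves u (@dcolor _ _ layer_color).
Proof. exact: (decolor_preserves uq layer_color_surj layer_colors_gt1). Qed.

Let translate_out s h k :
  u (gvert h (inr false)) (gvert k (inr false)) = u (gvert h (inl s)) (gvert k (inl s)).
Proof.
apply: (qperm_matching uq frucht_graph_preserves); rewrite /= /frucht_edge /arc /= ?eqxx ?orbT //.
  by case=> [[a|[k' l]]|w] //= [->]; rewrite /frucht_edge /arc /= => /eqP->.
by case=> [[a|[k' l]]|w] //= [->]; rewrite /frucht_edge /arc /= => /eqP->.
Qed.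

Let translate_in s h k :
  u (gvert h (inl s)) (gvert k (inl s)) =
  u (gvert (s * h) (inr true)) (gvert (s * k) (inr true)).
Proof.
apply: (qperm_matching uq frucht_graph_preserves); rewrite /= /frucht_edge /arc /= ?eqxx ?orbT //.
  by case=> [[a|[k' l]]|w] //= [->]; rewrite /frucht_edge /arc /= orbF => /eqP->.
by case=> [[a|[k' l]]|w] //= [->]; rewrite /frucht_edge /arc /= orbF => /eqP/mulgI->.
Qed.

(** Matchings give the equality of the entries at [(h, k)] in the source and midpoint layers, and at
[(h, k)] in the midpoint layer and [(s * h, s * k)] in the target layer.  The arcs with [s = 1]
identify sources with targets, and those with [s = h^-1] move [h] to [1]. *)
Lemma frucht_rigid h k l :
  u (gvert h l) (gvert k l) = u (gvert 1 (inr false)) (gvert (h^-1 * k) (inr false)).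
Proof.
have PQ h' k' : u (gvert h' (inr false)) (gvert k' (inr false)) =
                u (gvert h' (inr true)) (gvert k' (inr true)).
  by rewrite (translate_out 1%g) translate_in !mul1g.
have base : u (gvert h (inr false)) (gvert k (inr false)) =
            u (gvert 1 (inr false)) (gvert (h^-1 * k) (inr false)).
  by rewrite (translate_out h^-1%g) translate_in -PQ mulVg.
by rewrite -base; case: l => [s|[]].
Qed.

End Rigid.

Definition translate (g : gT) (x : frucht_graph) : frucht_graph :=
  if x is inl (inr (h, l)) then gvert (h * g) l else x.

Lemma translate_inj g : injective (translate g).
Proof.
by move=> [[a|[h l]]|w] [[a'|[h' l']]|w'] //= [] // /mulIg-> ->.
Qed.

Definition gperm g := perm (@translate_inj g).

Lemma gperm_morphM : {in [set: gT] &, {morph gperm : g g' / (g * g')%g}}.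
Proof.
move=> g g' _ _; apply/permP => x; rewrite permM !permE.
by case: x => [[a|[h l]]|w] //=; rewrite mulgA.
Qed.

Definition gmorph := Morphism gperm_morphM.

Lemma gperm_aut g : gperm g \in graph_aut frucht_graph.
Proof.
rewrite inE; apply/forallP => x; apply/forallP => y; rewrite !permE; apply/eqP.
have cg z : dcolor layer_color (translate g z) = dcolor layer_color z.
  by case: z => [[a|[h l]]|w].
apply: dedge_color; rewrite ?cg // => v w v' w'.
case: x y => [[a|[h l]]|?] [[a'|[h' l']]|?] //= [<-] [<-] [<-] [<-] //=.
rewrite /frucht_edge /arc /=.
by case: l l' => [s|[]] [s'|[]] //=; rewrite ?mulgA ?(inj_eq (mulIg g)).
Qed.

Hypothesis X_asym : forall s : X -> X, injective s ->
  (forall a, cX (s a) = cX a) -> (forall a b, edge (s a) (s b) = edge a b) -> s =1 id.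

(** By rigidity, an automorphism acts on all layers as the translation by the image of [1]; it fixes
the labels, which have colours of their own, and [X] by hypothesis. *)
Lemma aut_gperm s : s \in graph_aut frucht_graph -> exists g, s = gperm g.
Proof.
move=> s_aut; have uq := perm_qperm s_aut.
have sc x : dcolor layer_color (s x) = dcolor layer_color x.
  apply/esym/eqP/negPn/negP => /(frucht_graph_preserves uq)/eqP.
  by rewrite eqxx oner_eq0.
have [g sg] : exists g, s (gvert 1 (inr false)) = gvert g (inr false).
  by have := sc (gvert 1 (inr false)); case: (s _) => [[a|[g l]]|w] //= [->]; exists g.
exists g; apply/permP => -[[a|[h l]]|w]; rewrite permE /=; first last.
- by have := sc (inr w); case: (s _) => //= w' [->].
- have := frucht_rigid uq h (h * g) l; rewrite mulKg sg eqxx.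
  by case: eqP => [//|_] /eqP; rewrite eq_sym oner_eq0.
have [s' s'E] : exists s', forall b, s (xvert b) = xvert (s' b).
  apply: (fin_all_exists (P := fun b b' => s (xvert b) = xvert b')) => b.
  by have := sc (xvert b); case: (s _) => [[b'|[h l]]|w] //= [_]; exists b'.
have := X_asym (s := s'); rewrite -/(xvert a) s'E => -> //.
- by move=> b b' bb'; have /perm_inj[] : s (xvert b) = s (xvert b') by rewrite !s'E bb'.
- by move=> b; have := sc (xvert b); rewrite s'E => -[].
move=> b b'; move: s_aut; rewrite inE => /forallP/(_ (xvert b))/forallP/(_ (xvert b')).
by rewrite !s'E => /eqP.
Qed.

Lemma frucht_graph_aut : graph_aut frucht_graph \isog [set: gT].
Proof.
have inj : ('injm gmorph)%g.
  apply/injmP => g g' _ _ /permP/(_ (gvert 1 (inr false))).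
  by rewrite !permE /= !mul1g => -[].
have <- : (gmorph @* [set: gT])%g = graph_aut frucht_graph.
  apply/setP => s; apply/morphimP/idP => [[g _ _ ->]|/aut_gperm[g ->]].
    exact: gperm_aut.
  by exists g; rewrite ?inE.
by rewrite isog_sym sub_isog.
Qed.

End Frucht.

(** * Completeness of finite-dimensional norms *)

Section Completeness.
Variable R : realType.

Lemma real_cauchy_cvg (s : nat -> R) :
    (forall e, 0 < e -> exists N, forall m n,
       (N <= m)%N -> (N <= n)%N -> `|s m - s n| < e) ->
  exists l, forall e, 0 < e -> exists N, forall n, (N <= n)%N -> `|s n - l| < e.
Proof.
(* The limit is the limes inferior: the supremum of the eventual lower bounds. *)
move=> cs; pose S : classical_sets.set R := fun x => exists N, forall n, (N <= n)%N -> x <= s n.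
have near e : 0 < e -> exists N, (forall m n, (N <= m)%N -> (N <= n)%N -> `|s m - s n| < e) /\
    S (s N - e) /\ classical_sets.ubound S (s N + e).
  move=> e0; have [N hN] := cs e e0; exists N; split=> //; split.
    exists N => n Nn; have := hN N n (leqnn _) Nn; rewrite ltr_norml; lra.
  move=> x [M hM]; have := hM _ (leq_maxr N M).
  have := hN _ N (leq_maxl N M) (leqnn _); rewrite ltr_norml; lra.
have supS : classical_sets.has_sup S.
  by have [N [_ [SN uN]]] := near 1 ltr01; split; [exists (s N - 1) | exists (s N + 1)].
exists (sup S) => e e0; have [|N [hN [SN uN]]] := near (e / 2); first by lra.
exists N => n Nn; have := sup_upper_bound supS SN.
have := ge_sup supS.1 uN; have := hN n N Nn (leqnn _).
rewrite !ltr_norml; lra.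
Qed.

Lemma normc_ge0 (z : R[i]) : 0 <= normc z.
Proof. by case: z => a b; rewrite /normc sqrtr_ge0. Qed.

Lemma normc_ge_Re (z : R[i]) : `|complex.Re z| <= normc z.
Proof. by case: z => a b; rewrite /normc /= -sqrtr_sqr ler_wsqrtr // lerDl sqr_ge0. Qed.

Lemma normc_ge_Im (z : R[i]) : `|complex.Im z| <= normc z.
Proof. by case: z => a b; rewrite /normc /= -sqrtr_sqr ler_wsqrtr // lerDr sqr_ge0. Qed.

Lemma normc_le_ReIm (z : R[i]) : normc z <= `|complex.Re z| + `|complex.Im z|.
Proof.
case: z => a b; rewrite /normc /= -[leRHS]ger0_norm ?addr_ge0 // -sqrtr_sqr.
rewrite ler_wsqrtr // sqrrD !real_normK ?num_real //.
have : 0 <= `|a| * `|b| by rewrite mulr_ge0.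
by rewrite mulr2n; lra.
Qed.

Lemma complex_cauchy_cvg (s : nat -> R[i]) :
    (forall e, 0 < e -> exists N, forall m n,
       (N <= m)%N -> (N <= n)%N -> normc (s m - s n) < e) ->
  exists l, forall e, 0 < e -> exists N, forall n, (N <= n)%N -> normc (s n - l) < e.
Proof.
move=> cs.
have [e /cs[N hN]|a ha] := @real_cauchy_cvg (fun n => complex.Re (s n)).
  exists N => m n Nm Nn; rewrite -raddfB.
  exact: le_lt_trans (normc_ge_Re _) (hN _ _ Nm Nn).
have [e /cs[N hN]|b hb] := @real_cauchy_cvg (fun n => complex.Im (s n)).
  exists N => m n Nm Nn; rewrite -raddfB.
  exact: le_lt_trans (normc_ge_Im _) (hN _ _ Nm Nn).
exists (a +i* b)%C => e e0.
have e2 : 0 < e / 2 by rewrite divr_gt0.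
have [N hN] := ha _ e2; have [M hM] := hb _ e2; exists (maxn N M) => n.
rewrite geq_max => /andP[/hN Nn /hM Mn].
apply: le_lt_trans (normc_le_ReIm _) _; rewrite !raddfB /=; lra.
Qed.

(** The comparison with the coordinates turns completeness of a finite-dimensional normed space into
completeness of the complex numbers. *)
Lemma coordinates_complete (I : finType) (V : zmodType) (N : V -> R)
    (co : I -> V -> R[i]) :
    (forall f : I -> R[i], exists v, forall i, co i v = f i) ->
    (forall i, {morph co i : a b / a - b}) ->
    (forall i a, normc (co i a) <= N a) ->
    (forall a, N a <= \sum_i normc (co i a)) ->
  forall s : nat -> V,
    (forall e, 0 < e -> exists K, forall m n, (K <= m)%N -> (K <= n)%N -> N (s m - s n) < e) ->
  exists l, forall e, 0 < e -> exists K, forall n, (K <= n)%N -> N (s n - l) < e.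
Proof.
move=> co_surj coB co_le le_co s cs.
have [f hf] : exists f : I -> R[i], forall i, forall e, 0 < e ->
    exists K, forall n, (K <= n)%N -> normc (co i (s n) - f i) < e.
  apply: (fin_all_exists (P := fun i z => forall e, 0 < e ->
    exists K, forall n, (K <= n)%N -> normc (co i (s n) - z) < e)) => i.
  apply: complex_cauchy_cvg => e /cs[K hK]; exists K => m n Km Kn.
  by rewrite -coB; apply: le_lt_trans (co_le _ _) (hK _ _ Km Kn).
have [l lE] := co_surj f; exists l => e e0.
pose d := e / (#|I|%:R + 1).
have c0 : 0 < #|I|%:R + 1 :> R by rewrite ltr_wpDl.
have d0 : 0 < d by rewrite divr_gt0.
have [K hK] := fin_all_exists (fun i => hf i d d0).
exists (\max_i K i)%N => n Kn; apply: le_lt_trans (le_co _) _.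
apply: (@le_lt_trans _ _ (\sum_(i : I) d)).
  apply: ler_sum => i _; rewrite coB lE ltW // hK //.
  exact: leq_trans (leq_bigmax i) Kn.
rewrite sumr_const -mulr_natl /d mulrA ltr_pdivrMr // mulrC ltr_pM2l //.
by rewrite ltrDl.
Qed.

End Completeness.

(** * The C*-algebra of functions on a finite group *)
Section Functions.
Variables (R : realType) (gT : finGroupType).

(** Finite functions form a ring without the axiom [1 != 0]; the alias carries the algebra structure
that holds because a group is not empty. *)
Definition funs : Type := {ffun gT -> R[i]^o}.
HB.instance Definition _ := GRing.PzRing.on funs.
HB.instance Definition _ := GRing.Lmodule.on funs.

Lemma funs1_neq0 : (1 : funs) != 0.
Proof. by apply/eqP => /ffunP/(_ 1%g)/eqP; rewrite !ffunE oner_eq0. Qed.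

HB.instance Definition _ := GRing.PzSemiRing_isNonZero.Build funs funs1_neq0.

Lemma funs_scaleAl (k : R[i]) (f g : funs) : k *: (f * g) = k *: f * g.
Proof. by apply/ffunP => x; rewrite !ffunE /= scalerAl. Qed.
HB.instance Definition _ := GRing.Lmodule_isLalgebra.Build R[i] funs funs_scaleAl.

Lemma funs_scaleAr (k : R[i]) (f g : funs) : k *: (f * g) = f * (k *: g).
Proof. by apply/ffunP => x; rewrite !ffunE /= scalerAr. Qed.
HB.instance Definition _ := GRing.Lalgebra_isAlgebra.Build R[i] funs funs_scaleAr.

Implicit Types f g : funs.

Definition val_at (x : gT) f : R[i] := (f : {ffun gT -> R[i]^o}) x.

Lemma funsP f g : (forall x, val_at x f = val_at x g) -> f = g.
Proof. by move=> fg; apply/ffunP. Qed.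

Lemma val_atD x f g : val_at x (f + g) = val_at x f + val_at x g.
Proof. by rewrite /val_at ffunE. Qed.
Lemma val_atB x f g : val_at x (f - g) = val_at x f - val_at x g.
Proof. by rewrite /val_at !ffunE. Qed.
Lemma val_atM x f g : val_at x (f * g) = val_at x f * val_at x g.
Proof. by rewrite /val_at ffunE. Qed.
Lemma val_atZ x (k : R[i]) f : val_at x (k *: f) = k * val_at x f.
Proof. by rewrite /val_at ffunE. Qed.
Lemma val_at1 x : val_at x 1 = 1.
Proof. by rewrite /val_at ffunE. Qed.
Lemma val_at0 x : val_at x 0 = 0.
Proof. by rewrite /val_at ffunE. Qed.
Lemma val_at_sum x (I : finType) (F : I -> funs) :
  val_at x (\sum_i F i) = \sum_i val_at x (F i).
Proof. exact: (big_morph _ (val_atD x) (val_at0 x)). Qed.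

Definition mkfun (F : gT -> R[i]) : funs := [ffun x => (F x : R[i]^o)].

Lemma val_at_mkfun x F : val_at x (mkfun F) = F x.
Proof. by rewrite /val_at ffunE. Qed.

Definition funs_star f : funs := mkfun (fun x => (val_at x f)^*).

Lemma val_at_star x f : val_at x (funs_star f) = (val_at x f)^*.
Proof. exact: val_at_mkfun. Qed.

Definition supnorm f : R := \big[Order.max/0]_x normc (val_at x f).

Lemma supnorm_ge x f : normc (val_at x f) <= supnorm f.
Proof. exact: (le_bigmax _ (fun x => normc (val_at x f))). Qed.

Lemma supnorm_ge0 f : 0 <= supnorm f.
Proof. exact: le_trans (normc_ge0 _) (supnorm_ge 1%g f). Qed.

Lemma supnorm_le f (b : R) : (forall x, normc (val_at x f) <= b) -> supnorm f <= b.
Proof.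
move=> fb; apply/bigmax_le => // ; exact: le_trans (normc_ge0 _) (fb 1%g).
Qed.

Lemma normc_conj (z : R[i]) : normc z^* = normc z.
Proof. by case: z => a b; rewrite /normc /= sqrrN. Qed.

Fact funs_starK : involutive funs_star.
Proof. by move=> f; apply: funsP => x; rewrite !val_at_star conjCK. Qed.

Fact funs_starD : {morph funs_star : f g / f + g}.
Proof. by move=> f g; apply: funsP => x; rewrite val_atD !val_at_star val_atD rmorphD. Qed.

Fact funs_starZ (k : R[i]) f : funs_star (k *: f) = k^* *: funs_star f.
Proof. by apply: funsP => x; rewrite val_atZ !val_at_star val_atZ rmorphM. Qed.

Fact funs_starM f g : funs_star (f * g) = funs_star g * funs_star f.
Proof. by apply: funsP => x; rewrite val_atM !val_at_star val_atM rmorphM mulrC. Qed.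

Fact supnorm_eq0 f : supnorm f = 0 -> f = 0.
Proof.
move=> f0; apply: funsP => x; rewrite val_at0; apply: eq0_normc; apply/eqP.
by rewrite eq_le normc_ge0 -f0 supnorm_ge.
Qed.

Fact supnormD f g : supnorm (f + g) <= supnorm f + supnorm g.
Proof.
apply: supnorm_le => x; rewrite val_atD; apply: le_trans (le_normcD _ _) _.
by apply: lerD; apply: supnorm_ge.
Qed.

Fact supnormM f g : supnorm (f * g) <= supnorm f * supnorm g.
Proof.
by apply: supnorm_le => x; rewrite val_atM normcM ler_pM ?normc_ge0 ?supnorm_ge.
Qed.

Fact supnormZ (k : R[i]) f : supnorm (k *: f) = normc k * supnorm f.
Proof.
apply/eqP; rewrite eq_le; apply/andP; split.
  by apply: supnorm_le => x; rewrite val_atZ normcM ler_wpM2l ?normc_ge0 ?supnorm_ge.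
have [->|k0] := eqVneq k 0; first by rewrite normc0 mul0r supnorm_ge0.
have k1 : 0 < normc k by rewrite lt_def normc_ge0 andbT; apply: contra k0 => /eqP/eq0_normc->.
rewrite mulrC -ler_pdivlMr //; apply: supnorm_le => x.
by rewrite ler_pdivlMr // mulrC -normcM -val_atZ supnorm_ge.
Qed.

Fact supnorm_starM f : supnorm (funs_star f * f) = supnorm f ^+ 2.
Proof.
apply/eqP; rewrite eq_le; apply/andP; split.
  apply: supnorm_le => x; rewrite val_atM val_at_star normcM normc_conj -expr2.
  by rewrite ler_sqr ?nnegrE ?normc_ge0 ?supnorm_ge0 // supnorm_ge.
have h x : normc (val_at x f) <= Num.sqrt (supnorm (funs_star f * f)).
  rewrite -[leLHS]ger0_norm ?normc_ge0 // -sqrtr_sqr ler_wsqrtr //.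
  by apply: le_trans (supnorm_ge x _); rewrite val_atM val_at_star normcM normc_conj -expr2.
rewrite -[leRHS]sqr_sqrtr ?supnorm_ge0 // ler_sqr ?nnegrE ?sqrtr_ge0 ?supnorm_ge0 //.
exact: supnorm_le.
Qed.

Fact supnorm_complete (s : nat -> funs) :
    (forall e, 0 < e -> exists N, forall m n,
       (N <= m)%N -> (N <= n)%N -> supnorm (s m - s n) < e) ->
  exists l, forall e, 0 < e -> exists N, forall n, (N <= n)%N -> supnorm (s n - l) < e.
Proof.
apply: (@coordinates_complete _ _ _ supnorm val_at).
- by move=> F; exists (mkfun F) => x; rewrite val_at_mkfun.
- by move=> x f g; rewrite val_atB.
- exact: supnorm_ge.
move=> f; apply: supnorm_le => x; rewrite (bigD1 x) //= lerDl.
by apply: sumr_ge0 => y _; apply: normc_ge0.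
Qed.

Definition funs_cstar : cstarAlg R :=
  @CstarAlg R funs funs_star supnorm funs_starK funs_starD funs_starZ funs_starM
    supnorm_eq0 supnormD supnormZ supnormM supnorm_starM supnorm_complete.

End Functions.

(** * Absence of quantum symmetry *)

Definition no_edge : rel void := fun _ _ => false.

Definition void_graph : sgraph :=
  @SGraph void no_edge (fun _ _ => erefl) (fun _ => erefl).

Definition void_color : void_graph -> void := id.

Lemma void_color_surj t : exists a, void_color a = t.
Proof. by case: t. Qed.

Section NoQuantumSymmetry.
Variables (R : realType) (gT : finGroupType).
Let G := frucht_graph gT void_color.
Let P : gT + bool := inr false.

Lemma sum_pick (A : cstarAlg R) (I : finType) (F : I -> A) (i0 : I) (b : pred I) :
  b =1 pred1 i0 -> \sum_i ((b i)%:R : R[i]) *: F i = F i0.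
Proof.
move=> bE; rewrite (bigD1 i0) //= bE /= eqxx scale1r big1 ?addr0 // => i ii0.
by rewrite bE /= (negPf ii0) scale0r.
Qed.

(** Evaluation at [g] turns it into the permutation matrix of the translation by [g]. *)
Definition translation_magic (x y : G) : funs_cstar R gT :=
  mkfun (fun g => (translate g x == y)%:R : R[i]).

Lemma val_at_magic g x y :
  val_at g (translation_magic x y) = (translate g x == y)%:R.
Proof. exact: val_at_mkfun. Qed.

Lemma translation_magic_rel : magic_rel translation_magic.
Proof.
split=> [i j|i j|i|i|i j k l ne]; apply: funsP => g.
- by rewrite val_at_star val_at_magic rmorph_nat.
- by rewrite val_atM val_at_magic; case: eqP; rewrite ?mulr1 ?mulr0.
- rewrite (@val_at_sum R) val_at1 (bigD1 (translate g i)) //= val_at_magic eqxx big1 ?addr0 //.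
  by move=> l li; rewrite val_at_magic eq_sym (negPf li).
- pose i' := (gperm void_color g)^-1%g i.
  have tE : translate g i' = i by have := permKV (gperm void_color g) i; rewrite permE.
  rewrite (@val_at_sum R) val_at1 (bigD1 i') //= val_at_magic tE eqxx big1 ?addr0 //.
  by move=> l li; rewrite val_at_magic -tE (inj_eq (@translate_inj _ _ _ _ g)) (negPf li).
rewrite val_atM !val_at_magic val_at0.
have [ij|_] := eqVneq (translate g i) j; last by rewrite mul0r.
have [kl|_] := eqVneq (translate g k) l; last by rewrite mulr0.
have := gperm_aut void_color g; rewrite inE => /forallP/(_ i)/forallP/(_ k)/eqP.
by rewrite !permE ij kl => e; rewrite e eqxx in ne.
Qed.

Lemma translation_magic_base g h :
  val_at h (translation_magic (gvert void_color 1 P) (gvert void_color g P)) = (h == g)%:R.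
Proof.
rewrite val_at_magic /= mul1g; congr (nat_of_bool _)%:R.
by apply/eqP/eqP => [[]|->].
Qed.

Section Universal.
Variables (B : cstarAlg R) (v : G -> G -> B).
Hypothesis vm : magic_rel v.

Let vq := magic_rel_qperm vm.
Let vc := frucht_graph_preserves void_color_surj vq.
Let w (g : gT) : B := v (gvert void_color 1 P) (gvert void_color g P).

Lemma w_orth g h : w g * w h = ((g == h)%:R : R[i]) *: w g.
Proof.
have [->|gh] := eqVneq g h; first by rewrite scale1r; apply: magic_idem vm _ _.
rewrite scale0r; apply: qperm_row_orth vq _ _ _ _; apply: contra gh.
by case/eqP=> ->.
Qed.

Lemma w_spans_layer h l y :
  v (gvert void_color h l) y = \sum_g ((translate g (gvert void_color h l) == y)%:R : R[i]) *: w g.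
Proof.
have [/eqP cxy|nc] := boolP (dcolor (layer_color void_color) (gvert void_color h l) ==
                             dcolor (layer_color void_color) y).
  case: y cxy => [[[]|[k l']]|z] //= [<-].
  rewrite (sum_pick w (i0 := h^-1 * k)%g) => [|g].
    exact: (frucht_rigid void_color_surj vq h k l).
  apply/eqP/eqP => [[<-]|->]; first by rewrite mulKg.
  by rewrite mulKVg.
rewrite vc // big1 // => g _; case: eqP => [yE|]; rewrite ?scale0r //.
by rewrite -yE eqxx in nc.
Qed.

(** The row of [gvert 1 P] consists of the [w g] and of zeros. *)
Lemma w_sum : \sum_g w g = 1.
Proof.
rewrite -(magic_row vm (gvert void_color 1 P)); under [RHS]eq_bigr => y _ do rewrite w_spans_layer.
rewrite exchange_big; apply: eq_bigr => g _ /=.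
rewrite -scaler_suml -natr_sum (bigD1 (gvert void_color (1 * g) P)) //= eqxx.
by rewrite big1 ?scale1r // => y; rewrite eq_sym => /negPf->.
Qed.

Lemma w_spans x y : v x y = \sum_g ((translate g x == y)%:R : R[i]) *: w g.
Proof.
case: x => [[[]|[h l]]|z]; first exact: w_spans_layer.
have -> : \sum_g ((translate g (inr z : G) == y)%:R : R[i]) *: w g =
          \sum_g (((inr z : G) == y)%:R : R[i]) *: w g by [].
rewrite -scaler_sumr w_sum.
have [<-|/eqP zy] := eqVneq (inr z : G) y; last first.
  rewrite scale0r vc //; apply/negP => /eqP; case: y zy => [[[]|[k l]]|z'] //= zy [zz'].
  by rewrite zz' in zy.
rewrite scale1r -(magic_row vm (inr z)) (bigD1 (inr z)) //= big1 ?addr0 //.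
move=> x xz; rewrite vc //; apply: contra xz; case: x => [[[]|[k l]]|z'] //= /eqP [->] //.
Qed.

(** The homomorphism required by universality maps the indicator function of [g] to [w g]. *)
Definition induced (f : funs_cstar R gT) : B := \sum_g val_at g f *: w g.

Lemma induced_linear : linear induced.
Proof.
move=> k f f'; rewrite /induced scaler_sumr -big_split; apply: eq_bigr => g _ /=.
by rewrite val_atD val_atZ scalerDl scalerA.
Qed.

Lemma induced_monoid : monoid_morphism induced.
Proof.
split; first by rewrite -w_sum; apply: eq_bigr => g _; rewrite val_at1 scale1r.
move=> f f'; rewrite {2}/induced mulr_suml; apply: eq_bigr => g _.
rewrite /induced mulr_sumr (bigD1 g) //= big1 => [|h hg].
  by rewrite addr0 -scalerAl -scalerAr scalerA w_orth eqxx scale1r val_atM.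
by rewrite -scalerAl -scalerAr w_orth eq_sym (negPf hg) scale0r !scaler0.
Qed.

Lemma induced_star f : induced (star f) = star (induced f).
Proof.
rewrite /induced star_sum; apply: eq_bigr => g _.
by rewrite starZ (magic_star vm) val_at_star.
Qed.

Lemma induced_magic x y : induced (translation_magic x y) = v x y.
Proof. by rewrite w_spans; apply: eq_bigr => g _; rewrite val_at_magic. Qed.

End Universal.

(** The row of [gvert 1 P] already contains the indicator functions of all group elements. *)
Lemma translation_magic_gen (S : funs_cstar R gT -> Prop) :
  closed_star_subalg S -> (forall x y, S (translation_magic x y)) -> forall f, S f.
Proof.
move=> Sc Su f.
have -> : f = \sum_g val_at g f *: translation_magic (gvert void_color 1 P) (gvert void_color g P).
  apply: funsP => h; rewrite val_at_sum (bigD1 h) //= big1 => [|g gh].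
    by rewrite val_atZ translation_magic_base eqxx mulr1 addr0.
  by rewrite val_atZ translation_magic_base eq_sym (negPf gh) mulr0.
elim/big_rec: _ => [|g a _ Sa].
  by rewrite -(scale0r 1); apply/(subalgZ Sc)/(subalg1 Sc).
by apply: (subalgD Sc) => //; apply: (subalgZ Sc).
Qed.

Theorem frucht_no_quantum_symmetry : Qut_eq_Aut R G.
Proof.
exists (funs_cstar R gT), translation_magic; split; last first.
  by move=> f g; apply: funsP => x; rewrite !val_atM mulrC.
split; [exact: translation_magic_rel | exact: translation_magic_gen |].
move=> B v vm.
pose lin := GRing.isLinear.Build R[i] (funs_cstar R gT) B *:%R (induced v) (induced_linear v).
pose mon := GRing.isMonoidMorphism.Build (funs_cstar R gT) B (induced v) (induced_monoid vm).
pose f : {lrmorphism funs_cstar R gT -> B} := HB.pack (induced v) lin mon.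
exists f; split; [exact: induced_star | exact: induced_magic].
Qed.

End NoQuantumSymmetry.

(** * Extending quantum permutations by the identity *)
Section Extension.
Variables (R : realType) (A : cstarAlg R) (V : sgraph) (W : finType).
Variables (e : rel (V + W)) (es : symmetric e) (ei : irreflexive e).
Let G : sgraph := SGraph es ei.
Variable w : V -> V -> A.

Definition extend_by_id (x y : V + W) : A :=
  match x, y with
  | inl i, inl j => w i j
  | inr t, inr t' => (t == t')%:R
  | _, _ => 0
  end.

(** The relations between [V] and [W] hold as soon as vertices of [V] that [w] relates have the same
neighbours in [W]. *)
Lemma extend_by_id_magic_rel : magic_rel w ->
    (forall i j, e (inl i) (inl j) = edge i j) ->
    (forall i j t, e (inl i) (inr t) != e (inl j) (inr t) -> w i j = 0) ->
  @magic_rel R G A extend_by_id.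
Proof.
case=> ws wi wr wc we eV eVW.
have starn (b : bool) : star (b%:R : A) = b%:R by case: b; rewrite ?star1 ?star0.
have id_row t : \sum_t' (t == t' :> W)%:R = 1 :> A.
  by rewrite (bigD1 t) //= eqxx big1 ?addr0 // => t' /negPf; rewrite eq_sym => ->.
split.
- by case=> [i|t] [j|t'] /=; rewrite ?ws ?starn ?star0.
- case=> [i|t] [j|t'] /=; rewrite ?wi ?mulr0 //.
  by case: eqP; rewrite ?mulr1 ?mulr0.
- by case=> [i|t]; rewrite big_sumType /= ?wr ?id_row big1 ?addr0 ?add0r.
- case=> [i|t]; rewrite big_sumType /= ?wc; first by rewrite big1 ?addr0.
  by rewrite big1 ?add0r // -[RHS](id_row t); apply: eq_bigr => t' _; rewrite eq_sym.
case=> [i|t] [j|t'] [k|s] [l|s'] /=; rewrite ?mulr0 ?mul0r //.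
- by rewrite !eV; apply: we.
- by have [<-|_] := eqVneq s s'; rewrite ?mulr0 ?mulr1 //; apply: eVW.
- by have [<-|_] := eqVneq t t'; rewrite ?mul0r ?mul1r // !(es (inr t)); apply: eVW.
have [<-|_] := eqVneq t t'; rewrite ?mul0r ?mul1r //.
by have [<-|] := eqVneq s s'; rewrite ?eqxx.
Qed.

End Extension.

Section FruchtExtension.
Variables (R : realType) (A : cstarAlg R) (gT : finGroupType).
Variables (X : sgraph) (TX : finType) (cX : X -> TX) (w : X -> X -> A).

Definition frucht_extend : frucht_graph gT cX -> frucht_graph gT cX -> A :=
  extend_by_id (W := (TX + (gT + bool) + bool)%type)
    (extend_by_id (V := X) (W := (gT * (gT + bool))%type) w :
       disjoint_union X (frucht gT) -> disjoint_union X (frucht gT) -> A).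

Lemma frucht_extend_magic_rel : magic_rel w ->
  (forall i j, cX i != cX j -> w i j = 0) -> magic_rel frucht_extend.
Proof.
move=> wm wc; apply: extend_by_id_magic_rel => //.
- apply: extend_by_id_magic_rel => // i j t; rewrite /= eqxx.
move=> [i|i] [j|j] t //=; last first.
  have [->|_] := eqVneq i j; last by [].
  by rewrite eqxx.
move=> ne; apply: wc; apply: contra ne => /eqP cij.
by case: t => [t|b] //=; rewrite cij.
Qed.

(** A commutative universal algebra would map onto the entries of every magic unitary. *)
Lemma quantum_symmetry_of_component : magic_rel w ->
  (forall i j, cX i != cX j -> w i j = 0) ->
  (exists i j k l, w i j * w k l != w k l * w i j) ->
  ~ Qut_eq_Aut R (frucht_graph gT cX).
Proof.
move=> wm wc [i [j [k [l ne]]]] [B [u [uQ comm]]].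
have [f [_ fu]] := CQut_univ uQ (frucht_extend_magic_rel wm wc).
case/eqP: ne; have := comm (u (xvert gT cX i) (xvert gT cX j)) (u (xvert gT cX k) (xvert gT cX l)).
by move/(congr1 f); rewrite !rmorphM /= !fu.
Qed.

End FruchtExtension.

(** * Linear systems over the field with two elements *)
Section LinearSystem.
Variables (I E : finType) (lt md rt : E -> I).
Hypotheses (lm : forall q, lt q != md q) (lr : forall q, lt q != rt q).
Hypothesis mr : forall q, md q != rt q.

(** An unknown [i] has the two vertices [(i, b)]; an equation [lt q + md q = rt q] has four vertices,
one for each assignment of its unknowns that satisfies it, given by the values of the first two.
A satisfying assignment is adjacent to the three values that it gives. *)
Definition agrees (s : E * (bool * bool)) (v : I * bool) :=
  [|| (v.1 == lt s.1) && (v.2 == s.2.1),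
      (v.1 == md s.1) && (v.2 == s.2.2) |
      (v.1 == rt s.1) && (v.2 == s.2.1 (+) s.2.2)].

Definition system_edge : rel (I * bool + E * (bool * bool)) := fun x y =>
  match x, y with
  | inl v, inr s | inr s, inl v => agrees s v
  | _, _ => false
  end.

Lemma system_edge_sym : symmetric system_edge.
Proof. by move=> [v|s] [v'|s']. Qed.

Lemma system_edge_irr : irreflexive system_edge.
Proof. by move=> [v|s]. Qed.

Definition system_graph : sgraph := SGraph system_edge_sym system_edge_irr.

Definition system_color (x : system_graph) : I + E :=
  match x with inl v => inl v.1 | inr s => inr s.1 end.

Lemma system_color_surj t : exists x, system_color x = t.
Proof. by case: t => [i|q]; [exists (inl (i, false)) | exists (inr (q, (false, false)))]. Qed.

Lemma agrees_lt q b d : agrees (q, b) (lt q, d) = (d == b.1).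
Proof. by rewrite /agrees /= eqxx (negPf (lm q)) (negPf (lr q)) orbF. Qed.

Lemma agrees_md q b d : agrees (q, b) (md q, d) = (d == b.2).
Proof. by rewrite /agrees /= eqxx eq_sym (negPf (lm q)) (negPf (mr q)) orbF. Qed.

Lemma agrees_rt q b d : agrees (q, b) (rt q, d) = (d == b.1 (+) b.2).
Proof.
by rewrite /agrees /= eqxx ![rt q == _]eq_sym (negPf (lr q)) (negPf (mr q)).
Qed.

(** A colour-preserving automorphism flips the values of some unknowns; the vertices of an equation
force these flips to satisfy the equation. *)
Lemma system_graph_asym :
    (forall f : I -> bool, (forall q, f (lt q) (+) f (md q) = f (rt q)) -> f =1 xpred0) ->
  forall s : system_graph -> system_graph, injective s ->
    (forall a, system_color (s a) = system_color a) ->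
    (forall a b, edge (s a) (s b) = edge a b) -> s =1 id.
Proof.
move=> triv s s_inj sc se.
have [f fE] : exists f : I -> bool, forall i, s (inl (i, false)) = inl (i, f i).
  apply: (fin_all_exists (P := fun i d => s (inl (i, false)) = inl (i, d))) => i.
  by have := sc (inl (i, false)); case: (s _) => [[j d]|] //= [->]; exists d.
have sI i b : s (inl (i, b)) = inl (i, b (+) f i).
  case: b => //=; have := sc (inl (i, true)); case Es: (s _) => [[j d]|] //= [jE].
  have : d != f i; last by case: (d) (f i) => [] []; rewrite jE.
  apply/eqP => df; have : s (inl (i, true)) = s (inl (i, false)) by rewrite Es fE jE df.
  by move/s_inj.
have sE q b c : exists d, s (inr (q, (b, c))) = inr (q, d) /\
    [/\ d.1 = b (+) f (lt q), d.2 = c (+) f (md q) & d.1 (+) d.2 = b (+) c (+) f (rt q)].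
  have := sc (inr (q, (b, c))); case Es: (s _) => [|[q' d]] //= [qE]; exists d; split.
    by rewrite qE.
  rewrite qE in Es; split.
  - have := se (inr (q, (b, c))) (inl (lt q, b)).
    by rewrite Es sI /= !agrees_lt eqxx => /eqP->.
  - have := se (inr (q, (b, c))) (inl (md q, c)).
    by rewrite Es sI /= !agrees_md eqxx => /eqP->.
  have := se (inr (q, (b, c))) (inl (rt q, b (+) c)).
  by rewrite Es sI /= !agrees_rt eqxx => /eqP->.
have f0 : f =1 xpred0.
  apply: triv => q; have [d [_ [-> -> ]]] := sE q false false.
  by [].
case=> [[i b]|[q [b c]]]; first by rewrite sI f0 addbF.
by have [[d d'] [-> /= [-> -> _]]] := sE q b c; rewrite !f0 !addbF.
Qed.

Section Operators.
Variables (R : realType) (A : cstarAlg R) (op : I -> A).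
Hypotheses (op_star : forall i, star (op i) = op i) (op_sqr : forall i, op i * op i = 1).
Hypotheses (op_lm : forall q, op (lt q) * op (md q) = op (rt q)).
Hypothesis op_ml : forall q, op (md q) * op (lt q) = op (rt q).

(** The spectral projection of the involution [op i] for the eigenvalue [(-1) ^+ b]. *)
Definition spec i (b : bool) : A := (2^-1 : R[i]) *: (1 + ((-1) ^+ b : R[i]) *: op i).

Lemma spec_star i b : star (spec i b) = spec i b.
Proof.
rewrite /spec starZ starD star1 starZ op_star fmorphV rmorph_nat.
by rewrite rmorph_sign.
Qed.

Lemma spec_op i b : spec i b * op i = ((-1) ^+ b : R[i]) *: spec i b.
Proof.
rewrite /spec -scalerAl mulrDl mul1r -scalerAl op_sqr [RHS]scalerA (mulrC _ 2^-1).
rewrite -[RHS]scalerA; congr (_ *: _).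
by rewrite scalerDr scalerA -expr2 sqrr_sign scale1r addrC.
Qed.

Lemma spec_absorb (a : A) i (b d : bool) : a * op i = ((-1) ^+ b : R[i]) *: a ->
  a * spec i d = ((d == b)%:R : R[i]) *: a.
Proof.
move=> ab; rewrite /spec -scalerAr mulrDr mulr1 -scalerAr ab scalerA.
rewrite -{1}(scale1r a) -scalerDl scalerA.
congr (_ *: _).
by case: d b {ab} => [] [] /=; field.
Qed.

Lemma spec_sum i b : spec i b + spec i (~~ b) = 1.
Proof.
rewrite /spec -scalerDr addrACA -scalerDl signrN subrr scale0r addr0.
have -> : 1 + 1 = (2 : R[i]) *: (1 : A) by rewrite scaler_nat mulr2n.
by rewrite scalerA mulVf ?scale1r ?pnatr_eq0.
Qed.

Lemma spec_comm q b c : spec (lt q) b * spec (md q) c = spec (md q) c * spec (lt q) b.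
Proof.
rewrite /spec -!scalerAl -!scalerAr !mulrDl !mulrDr !mul1r !mulr1 -!scalerAl -!scalerAr.
rewrite op_lm op_ml !scalerA (mulrC ((-1) ^+ b) ((-1) ^+ c)); congr (_ *: _).
by rewrite -!addrA; congr (_ + _); rewrite addrCA.
Qed.

(** The joint spectral projection of the three commuting involutions of an equation, with eigenvalues
given by [b], [c] and their sum. *)
Definition joint q b c := spec (lt q) b * spec (md q) c.

Lemma joint_star q b c : star (joint q b c) = joint q b c.
Proof. by rewrite /joint starM !spec_star spec_comm. Qed.

Lemma joint_lt_op q b c : joint q b c * op (lt q) = ((-1) ^+ b : R[i]) *: joint q b c.
Proof. by rewrite /joint spec_comm -mulrA spec_op scalerAr. Qed.

Lemma joint_md_op q b c : joint q b c * op (md q) = ((-1) ^+ c : R[i]) *: joint q b c.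
Proof. by rewrite /joint -mulrA spec_op scalerAr. Qed.

Lemma joint_lt q b c d : joint q b c * spec (lt q) d = ((d == b)%:R : R[i]) *: joint q b c.
Proof. exact/spec_absorb/joint_lt_op. Qed.

Lemma joint_md q b c d : joint q b c * spec (md q) d = ((d == c)%:R : R[i]) *: joint q b c.
Proof. exact/spec_absorb/joint_md_op. Qed.

Lemma joint_rt q b c d :
  joint q b c * spec (rt q) d = ((d == b (+) c)%:R : R[i]) *: joint q b c.
Proof.
apply: spec_absorb; rewrite -op_lm mulrA joint_lt_op -scalerAl joint_md_op scalerA.
by rewrite signr_addb.
Qed.

Lemma joint_idem q b c : joint q b c * joint q b c = joint q b c.
Proof. by rewrite {2}/joint mulrA joint_lt eqxx scale1r joint_md eqxx scale1r. Qed.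

Lemma spec_idem i b : spec i b * spec i b = spec i b.
Proof. by rewrite (spec_absorb _ (spec_op i b)) eqxx scale1r. Qed.

Lemma joint_sum q b c : \sum_(d : bool * bool) joint q (b (+) d.1) (c (+) d.2) = 1.
Proof.
rewrite -(pair_bigA _ (fun d d' => joint q (b (+) d) (c (+) d'))) /= big_bool !big_bool /=.
rewrite /joint !addbT !addbF -!mulrDr ![spec _ (~~ c) + _]addrC !spec_sum !mulr1.
by rewrite addrC spec_sum.
Qed.

(** Translation of the values by the joint spectrum: the entry from one value (or assignment) to
another is the spectral projection of their difference. *)
Definition system_magic (x y : system_graph) : A :=
  match x, y with
  | inl v, inl v' => if v.1 == v'.1 then spec v.1 (v.2 (+) v'.2) else 0
  | inr s, inr s' =>
      if s.1 == s'.1 then joint s.1 (s.2.1 (+) s'.2.1) (s.2.2 (+) s'.2.2) else 0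
  | _, _ => 0
  end.

Lemma system_magic_color x y :
  system_color x != system_color y -> system_magic x y = 0.
Proof.
case: x y => [[i b]|[q [b c]]] [[j b']|[q' [b' c']]] //=.
  by have [->|//] := eqVneq i j; rewrite eqxx.
by have [->|//] := eqVneq q q'; rewrite eqxx.
Qed.

Lemma system_magic_star x y : star (system_magic x y) = system_magic x y.
Proof.
by case: x y => [[i b]|[q [b c]]] [[j b']|[q' [b' c']]] /=;
  rewrite ?star0 //; case: ifP => _; rewrite ?star0 ?spec_star ?joint_star.
Qed.

Lemma system_magic_sym x y : system_magic x y = system_magic y x.
Proof.
case: x y => [[i b]|[q [b c]]] [[j b']|[q' [b' c']]] //=.
  by rewrite eq_sym; case: eqP => [->|] //; rewrite addbC.
by rewrite eq_sym; case: eqP => [->|] //; rewrite addbC (addbC c).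
Qed.

Lemma system_magic_row x : \sum_y system_magic x y = 1.
Proof.
case: x => [[i b]|[q [b c]]]; rewrite big_sumType /=.
  rewrite [X in _ + X]big1 => [|[q [b' c']]] //; rewrite addr0.
  rewrite (eq_bigr (fun v => if i == v.1 then spec i (b (+) v.2) else 0)); last by case.
  rewrite -(pair_bigA _ (fun j b' => if i == j then spec i (b (+) b') else 0)) /=.
  rewrite (bigD1 i) //= eqxx big_bool /= addbT addbF [X in X + _]addrC spec_sum.
  rewrite big1 ?addr0 // => j ji.
  by rewrite eq_sym (negPf ji) big1.
rewrite big1 ?add0r => [|[j b']] //.
rewrite (eq_bigr (fun s => if q == s.1 then joint q (b (+) s.2.1) (c (+) s.2.2) else 0));
  last by case=> ? [].
rewrite -(pair_bigA _ (fun q' d => if q == q' then joint q (b (+) d.1) (c (+) d.2) else 0)) /=.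
rewrite (bigD1 q) //= eqxx joint_sum big1 ?addr0 // => j jq.
by rewrite eq_sym (negPf jq) big1.
Qed.

Lemma system_magic_edge s s' v v' :
  agrees s v != agrees s' v' -> system_magic (inr s) (inr s') * system_magic (inl v) (inl v') = 0.
Proof.
case: s s' v v' => [q [b c]] [q' [b' c']] [i d] [j d'] /=.
have [<-|_] := eqVneq q q'; last by rewrite mul0r.
have [<-|_] := eqVneq i j; last by rewrite mulr0.
have [->|il] := eqVneq i (lt q).
  by rewrite !agrees_lt joint_lt /=; case: b b' d d' => [] [] [] [] //=; rewrite scale0r.
have [->|im] := eqVneq i (md q).
  by rewrite !agrees_md joint_md /=; case: c c' d d' => [] [] [] [] //=; rewrite scale0r.
have [->|ir] := eqVneq i (rt q).
  rewrite !agrees_rt joint_rt /=.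
  by case: b b' c c' d d' => [] [] [] [] [] [] //=; rewrite scale0r.
by rewrite /agrees /= (negPf il) (negPf im) (negPf ir).
Qed.

Lemma system_magic_rel : magic_rel system_magic.
Proof.
split.
- exact: system_magic_star.
- case=> [[i b]|[q [b c]]] [[j b']|[q' [b' c']]] /=; rewrite ?mulr0 //;
    by case: ifP => _; rewrite ?mulr0 ?spec_idem ?joint_idem.
- exact: system_magic_row.
- by move=> y; rewrite -(system_magic_row y); apply: eq_bigr => x _; rewrite system_magic_sym.
have edge_rev s s' v v' : agrees s v != agrees s' v' ->
    system_magic (inl v) (inl v') * system_magic (inr s) (inr s') = 0.
  move=> ne; rewrite -[LHS]starK starM !system_magic_star.
  by rewrite (system_magic_edge ne) star0.
case=> [v|s] [v'|s'] [v1|s1] [v1'|s1'] ne //; rewrite /= ?mul0r ?mulr0 //.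
- exact: edge_rev.
- exact: system_magic_edge.
Qed.

Lemma system_magic_noncomm : (exists i j, op i * op j != op j * op i) ->
  exists x x' y y',
    system_magic x x' * system_magic y y' != system_magic y y' * system_magic x x'.
Proof.
move=> [i [j ne]].
exists (inl (i, false)), (inl (i, false)), (inl (j, false)), (inl (j, false)).
rewrite /= !eqxx /=; apply: contra ne => /eqP.
move=> comm.
have opE k : op k = (2 : R[i]) *: spec k false - 1.
  by rewrite /spec scalerA mulfV ?pnatr_eq0 // !scale1r addrC addKr.
have comm2 : GRing.comm ((2 : R[i]) *: spec i false) ((2 : R[i]) *: spec j false).
  by rewrite /GRing.comm -!(scalerAl (2 : R[i])) -!(scalerAr (2 : R[i])) comm.
apply/eqP; rewrite !opE; apply: commrB; last exact: commr1.
by apply/commr_sym/commrB; [apply: commr_sym | apply: commr1].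
Qed.

End Operators.
End LinearSystem.

(** * The C*-algebra of matrices *)
Section Matrices.
Variables (R : realType) (n : nat).
Notation C := R[i].
Implicit Types (x y : 'cV[C]_n.+1) (A B : 'M[C]_n.+1).

Definition vnorm x : R := Num.sqrt (\sum_i normc (x i 0) ^+ 2).

Lemma vnorm_sqr x : vnorm x ^+ 2 = \sum_i normc (x i 0) ^+ 2.
Proof. by rewrite sqr_sqrtr // sumr_ge0 // => i _; rewrite sqr_ge0. Qed.

Lemma vnorm_ge0 x : 0 <= vnorm x.
Proof. exact: sqrtr_ge0. Qed.

Lemma vnorm_le x (b : R) : 0 <= b -> vnorm x ^+ 2 <= b ^+ 2 -> vnorm x <= b.
Proof. by move=> b0; rewrite ler_sqr ?nnegrE ?vnorm_ge0. Qed.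

Lemma entry_le_vnorm x i : normc (x i 0) <= vnorm x.
Proof.
rewrite -[leLHS]ger0_norm ?normc_ge0 // -sqrtr_sqr ler_wsqrtr //.
by rewrite (bigD1 i) //= lerDl sumr_ge0 // => j _; rewrite sqr_ge0.
Qed.

(** Lagrange's identity: the defect is half the sum of the squares of [a i * b j - a j * b i]. *)
Lemma real_cauchy_schwarz (I : finType) (a b : I -> R) :
    (forall i, 0 <= a i) -> (forall i, 0 <= b i) ->
  (\sum_i a i * b i) ^+ 2 <= (\sum_i a i ^+ 2) * (\sum_i b i ^+ 2).
Proof.
move=> a0 b0; rewrite -subr_ge0 -(pmulr_rge0 _ (ltr0n R 2)).
have -> : 2 * ((\sum_i a i ^+ 2) * (\sum_i b i ^+ 2) - (\sum_i a i * b i) ^+ 2) =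
          \sum_i \sum_j (a i * b j - a j * b i) ^+ 2.
  pose f i j := a i ^+ 2 * b j ^+ 2; pose g i j := (a i * b i) * (a j * b j).
  have fE : (\sum_i a i ^+ 2) * (\sum_i b i ^+ 2) = \sum_i \sum_j f i j.
    by rewrite mulr_suml; apply: eq_bigr => i _; rewrite mulr_sumr.
  have gE : (\sum_i a i * b i) ^+ 2 = \sum_i \sum_j g i j.
    by rewrite expr2 mulr_suml; apply: eq_bigr => i _; rewrite mulr_sumr.
  have -> : \sum_i \sum_j (a i * b j - a j * b i) ^+ 2 =
            \sum_i \sum_j (f i j + f j i - (g i j + g i j)).
    by apply: eq_bigr => i _; apply: eq_bigr => j _; rewrite /f /g; ring.
  under [RHS]eq_bigr => i _ do rewrite sumrB !big_split.
  rewrite sumrB !big_split /= [X in _ + X - _]exchange_big -fE -gE /=; ring.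
by rewrite sumr_ge0 // => i _; rewrite sumr_ge0 // => j _; rewrite sqr_ge0.
Qed.

Lemma sum_normc_le x y : \sum_i normc (x i 0) * normc (y i 0) <= vnorm x * vnorm y.
Proof.
have s0 : 0 <= \sum_i normc (x i 0) * normc (y i 0).
  by rewrite sumr_ge0 // => i _; rewrite mulr_ge0 ?normc_ge0.
rewrite -ler_sqr ?nnegrE ?mulr_ge0 ?vnorm_ge0 // exprMn !vnorm_sqr.
by apply: real_cauchy_schwarz => i; apply: normc_ge0.
Qed.

Lemma normc_sum (I : finType) (F : I -> C) : normc (\sum_i F i) <= \sum_i normc (F i).
Proof.
elim/big_rec2: _ => [|i a b _ ab]; first by rewrite normc0.
by apply: le_trans (le_normcD _ _) _; rewrite lerD2l.
Qed.

Lemma vnormD x y : vnorm (x + y) <= vnorm x + vnorm y.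
Proof.
apply: vnorm_le; first by rewrite addr_ge0 ?vnorm_ge0.
apply: (@le_trans _ _ (\sum_i (normc (x i 0) + normc (y i 0)) ^+ 2)).
  rewrite vnorm_sqr; apply: ler_sum => i _; rewrite ler_sqr ?nnegrE ?addr_ge0 ?normc_ge0 //.
  by rewrite mxE le_normcD.
have -> : \sum_i (normc (x i 0) + normc (y i 0)) ^+ 2 =
    vnorm x ^+ 2 + (\sum_i normc (x i 0) * normc (y i 0)) *+ 2 + vnorm y ^+ 2.
  by rewrite !vnorm_sqr -sumrMnl -!big_split; apply: eq_bigr => i _; rewrite sqrrD.
by rewrite sqrrD lerD2r lerD2l lerMn2r sum_normc_le.
Qed.

Lemma vnormZ (k : C) x : vnorm (k *: x) = normc k * vnorm x.
Proof.
rewrite /vnorm; under eq_bigr => i _ do rewrite mxE normcM exprMn.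
by rewrite -mulr_sumr sqrtrM ?sqr_ge0 // sqrtr_sqr ger0_norm ?normc_ge0.
Qed.

Definition ip x y : C := \sum_i (x i 0)^* * y i 0.

Lemma ip_le x y : normc (ip x y) <= vnorm x * vnorm y.
Proof.
apply: le_trans (normc_sum _) (le_trans _ (sum_normc_le x y)).
by apply: ler_sum => i _; rewrite normcM normc_conj.
Qed.

Lemma normc_ip x : normc (ip x x) = vnorm x ^+ 2.
Proof.
have -> : ip x x = (vnorm x ^+ 2)%:C%C.
  rewrite vnorm_sqr rmorph_sum; apply: eq_bigr => i _.
  case: (x i 0) => a b; apply/eqP; rewrite eq_complex /= sqr_sqrtr ?addr_ge0 ?sqr_ge0 //.
  by apply/andP; split; apply/eqP; rewrite /=; ring.
by rewrite normc_real ger0_norm // sqr_ge0.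
Qed.

Definition mstar A : 'M[C]_n.+1 := (map_mx Num.conj A)^T.

Lemma ip_adj A x y : ip (A *m x) y = ip x (mstar A *m y).
Proof.
rewrite /ip; under eq_bigr => i _ do rewrite mxE rmorph_sum mulr_suml.
rewrite exchange_big; apply: eq_bigr => j _ /=; rewrite mxE mulr_sumr.
by apply: eq_bigr => i _; rewrite !mxE rmorphM /= mulrCA mulrA.
Qed.

Definition is_bound A (b : R) := 0 <= b /\ forall x, vnorm (A *m x) <= b * vnorm x.

(** Besides showing that [opnorm] is finite, this compares it with the entries, as completeness
requires. *)
Lemma entries_bound A : is_bound A (\sum_(p : 'I_n.+1 * 'I_n.+1) normc (A p.1 p.2)).
Proof.
split=> [|x]; first by rewrite sumr_ge0 // => p _; apply: normc_ge0.
have vle : vnorm (A *m x) <= \sum_i normc ((A *m x) i 0).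
  apply: vnorm_le; first by rewrite sumr_ge0 // => i _; apply: normc_ge0.
  rewrite vnorm_sqr expr2 mulr_suml; apply: ler_sum => i _; rewrite expr2.
  rewrite ler_wpM2l ?normc_ge0 // (bigD1 i) //= lerDl sumr_ge0 // => j _.
  exact: normc_ge0.
apply: le_trans vle _; rewrite -(pair_bigA _ (fun i j => normc (A i j))) mulr_suml /=.
apply: ler_sum => i _; rewrite mxE mulr_suml; apply: le_trans (normc_sum _) _.
by apply: ler_sum => j _; rewrite normcM ler_wpM2l ?normc_ge0 ?entry_le_vnorm.
Qed.

Definition opnorm A : R := inf (is_bound A).

Lemma opnorm_has_inf A : classical_sets.has_inf (is_bound A).
Proof. by split; [eexists; exact: entries_bound | exists 0 => b []]. Qed.

Lemma opnorm_le A (b : R) : is_bound A b -> opnorm A <= b.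
Proof. by move=> Ab; apply: ge_inf Ab; have [] := opnorm_has_inf A. Qed.

Lemma opnorm_ge0 A : 0 <= opnorm A.
Proof. by apply: lb_le_inf => [|b []//]; have [] := opnorm_has_inf A. Qed.

(** The infimum that defines [opnorm] is attained. *)
Lemma opnorm_bound A x : vnorm (A *m x) <= opnorm A * vnorm x.
Proof.
have [x0|x0] := eqVneq (vnorm x) 0.
  by have [_ /(_ x)] := entries_bound A; rewrite x0 !mulr0.
have xpos : 0 < vnorm x by rewrite lt_def x0 vnorm_ge0.
rewrite -ler_pdivrMr //; apply: lb_le_inf; first by have [] := opnorm_has_inf A.
by move=> b [_ Ab]; rewrite ler_pdivrMr.
Qed.

Lemma entry_le_opnorm A i j : normc (A i j) <= opnorm A.
Proof.
have vd : vnorm (delta_mx j 0) = 1.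
  rewrite /vnorm (bigD1 j) //= big1 => [|k kj]; rewrite mxE ?eqxx ?(negPf kj) /=.
    by rewrite expr0n /= !expr1n !addr0 sqrtr1 expr1n sqrtr1.
  by rewrite expr0n /= addr0 sqrtr0 expr0n.
have := opnorm_bound A (delta_mx j 0); rewrite vd mulr1; apply: le_trans.
have -> : A i j = (A *m (delta_mx j 0 : 'cV_n.+1)) i 0.
  rewrite mxE (bigD1 j) //= mxE !eqxx mulr1 big1 ?addr0 // => k kj.
  by rewrite mxE (negPf kj) mulr0.
exact: entry_le_vnorm.
Qed.

Fact mstarK : involutive mstar.
Proof. by move=> A; apply/matrixP => i j; rewrite !mxE conjCK. Qed.

Fact mstarD : {morph mstar : A B / A + B}.
Proof. by move=> A B; apply/matrixP => i j; rewrite !mxE rmorphD. Qed.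

Fact mstarZ (k : C) A : mstar (k *: A) = k^* *: mstar A.
Proof. by apply/matrixP => i j; rewrite !mxE rmorphM. Qed.

Fact mstarM A B : mstar (A * B) = mstar B * mstar A.
Proof. by rewrite /mstar map_mxM trmx_mul. Qed.

Fact opnorm_eq0 A : opnorm A = 0 -> A = 0.
Proof.
move=> A0; apply/matrixP => i j; rewrite mxE; apply: eq0_normc; apply/eqP.
by rewrite eq_le normc_ge0 -A0 entry_le_opnorm.
Qed.

Fact opnormD A B : opnorm (A + B) <= opnorm A + opnorm B.
Proof.
apply: opnorm_le; split=> [|x]; first by rewrite addr_ge0 ?opnorm_ge0.
rewrite mulmxDl mulrDl; apply: le_trans (vnormD _ _) _.
by apply: lerD; apply: opnorm_bound.
Qed.

Fact opnormM A B : opnorm (A * B) <= opnorm A * opnorm B.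
Proof.
apply: opnorm_le; split=> [|x]; first by rewrite mulr_ge0 ?opnorm_ge0.
rewrite -mulmxA -mulrA; apply: le_trans (opnorm_bound _ _) _.
by rewrite ler_wpM2l ?opnorm_ge0 ?opnorm_bound.
Qed.

Let opnormZ_le (k : C) A : opnorm (k *: A) <= normc k * opnorm A.
Proof.
apply: opnorm_le; split=> [|x]; first by rewrite mulr_ge0 ?normc_ge0 ?opnorm_ge0.
by rewrite -scalemxAl vnormZ -mulrA ler_wpM2l ?normc_ge0 ?opnorm_bound.
Qed.

Fact opnormZ (k : C) A : opnorm (k *: A) = normc k * opnorm A.
Proof.
apply/eqP; rewrite eq_le opnormZ_le /=.
have [->|k0] := eqVneq k 0; first by rewrite normc0 mul0r opnorm_ge0.
have k1 : 0 < normc k by rewrite lt_def normc_ge0 andbT; apply: contra k0 => /eqP/eq0_normc->.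
have := opnormZ_le k^-1 (k *: A); rewrite scalerA mulVf // scale1r normcV.
by rewrite [_^-1 * _]mulrC ler_pdivlMr // mulrC.
Qed.

(** The square of the norm of [A x] is the inner product of [x] with [A* A x]. *)
Let opnorm_sqr_le A : opnorm A ^+ 2 <= opnorm (mstar A * A).
Proof.
rewrite -[leRHS]sqr_sqrtr ?opnorm_ge0 // ler_sqr ?nnegrE ?sqrtr_ge0 ?opnorm_ge0 //.
apply: opnorm_le; split=> [|x]; first exact: sqrtr_ge0.
apply: vnorm_le; first by rewrite mulr_ge0 ?sqrtr_ge0 ?vnorm_ge0.
rewrite exprMn [Num.sqrt (opnorm _) ^+ 2]sqr_sqrtr ?opnorm_ge0 // -normc_ip ip_adj mulmxA.
apply: le_trans (ip_le _ _) _; rewrite mulrC expr2 mulrA.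
by rewrite ler_wpM2r ?vnorm_ge0 ?opnorm_bound.
Qed.

Let opnorm_star_le A : opnorm (mstar A) <= opnorm A.
Proof.
have := opnorm_sqr_le (mstar A); rewrite mstarK => /le_trans/(_ (opnormM _ _)).
have [->|a0] := eqVneq (opnorm (mstar A)) 0; first by rewrite opnorm_ge0.
by rewrite expr2 ler_pM2r // lt_def a0 opnorm_ge0.
Qed.

Fact opnorm_starM A : opnorm (mstar A * A) = opnorm A ^+ 2.
Proof.
apply/eqP; rewrite eq_le opnorm_sqr_le andbT; apply: le_trans (opnormM _ _) _.
by rewrite expr2 ler_wpM2r ?opnorm_ge0 ?opnorm_star_le.
Qed.

Fact opnorm_complete (s : nat -> 'M[C]_n.+1) :
    (forall e, 0 < e -> exists N, forall m k,
       (N <= m)%N -> (N <= k)%N -> opnorm (s m - s k) < e) ->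
  exists l, forall e, 0 < e -> exists N, forall k, (N <= k)%N -> opnorm (s k - l) < e.
Proof.
apply: (@coordinates_complete _ _ _ opnorm (fun (p : 'I_n.+1 * 'I_n.+1) A => A p.1 p.2)).
- by move=> F; exists (\matrix_(i, j) F (i, j)) => -[i j]; rewrite mxE.
- by move=> p A B; rewrite !mxE.
- by move=> p A; apply: entry_le_opnorm.
by move=> A; apply/opnorm_le/entries_bound.
Qed.

Definition matrix_cstar : cstarAlg R :=
  @CstarAlg R 'M[C]_n.+1 mstar opnorm mstarK mstarD mstarZ mstarM
    opnorm_eq0 opnormD opnormZ opnormM opnorm_starM opnorm_complete.

End Matrices.

(** * Functions additive on commuting double transpositions *)

Ltac split_uniq U :=
  move: U; rewrite /= !inE !negb_or => U;
  repeat match goal with H : is_true (_ && _) |- _ => case/andP: H => ? ? end.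

Ltac distinct :=
  rewrite /= ?inE ?negb_or; repeat (apply/andP; split);
  solve [done | assumption | rewrite eq_sym; assumption].

Ltac eval_tperm :=
  rewrite ?permM ?permE /=;
  repeat first
    [ rewrite eqxx /=
    | match goal with
      | H : is_true (?u != ?v) |- context [?u == ?v] => rewrite (negPf H) /=
      | H : is_true (?u != ?v) |- context [?v == ?u] => rewrite (eq_sym v u) (negPf H) /=
      end ].

Section DoubleTranspositions.
Variable T : finType.
Implicit Types (a b c d x y p q : T) (s t : {perm T}).

Definition dtperm a b c d : {perm T} := (tperm a b * tperm c d)%g.

Lemma tperm_disjointC a b c d : uniq [:: a; b; c; d] ->
  (tperm a b * tperm c d = tperm c d * tperm a b)%g.
Proof.
by move=> U; split_uniq U; rewrite conjgC tpermJ !tpermD //; distinct.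
Qed.

Lemma dtpermCA a b c d : uniq [:: a; b; c; d] -> dtperm c d a b = dtperm a b c d.
Proof. by move=> U; rewrite /dtperm tperm_disjointC //; split_uniq U; distinct. Qed.

Lemma dtperm_sqr a b c d : uniq [:: a; b; c; d] -> (dtperm a b c d * dtperm a b c d = 1)%g.
Proof.
by move=> U; rewrite /dtperm {1}tperm_disjointC // mulgA -(mulgA (tperm c d)) tperm2 mulg1 tperm2.
Qed.

Lemma dtperm_share a b c d p q : uniq [:: p; q; a; b; c; d] ->
  (dtperm p q a b * dtperm p q c d = dtperm a b c d)%g.
Proof.
move=> U; split_uniq U; rewrite /dtperm (@tperm_disjointC p q a b); last by distinct.
by rewrite mulgA -(mulgA (tperm a b)) tperm2 mulg1.
Qed.

Lemma dtperm_klein a b c d : uniq [:: a; b; c; d] ->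
  (dtperm a b c d * dtperm a c b d = dtperm a d b c)%g.
Proof.
move=> U; split_uniq U; apply/permP => x; rewrite /dtperm.
have [->|xa] := eqVneq x a; first by eval_tperm.
have [->|xb] := eqVneq x b; first by eval_tperm.
have [->|xc] := eqVneq x c; first by eval_tperm.
have [->|xd] := eqVneq x d; first by eval_tperm.
by eval_tperm.
Qed.

Definition double_transposition s :=
  [exists a, exists b, exists c, exists d, uniq [:: a; b; c; d] && (s == dtperm a b c d)].

Lemma double_transpositionP s :
  reflect (exists a b c d, uniq [:: a; b; c; d] /\ s = dtperm a b c d) (double_transposition s).
Proof.
apply: (iffP existsP) => [[a /existsP[b /existsP[c /existsP[d /andP[U /eqP ->]]]]]|].
  by exists a, b, c, d.
move=> [a [b [c [d [U ->]]]]]; exists a; apply/existsP; exists b; apply/existsP; exists c.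
by apply/existsP; exists d; rewrite U eqxx.
Qed.

Lemma dtperm_dt a b c d : uniq [:: a; b; c; d] -> double_transposition (dtperm a b c d).
Proof. by move=> U; apply/double_transpositionP; exists a, b, c, d. Qed.

Lemma double_transposition_sqr s : double_transposition s -> (s * s = 1)%g.
Proof. by case/double_transpositionP => a [b [c [d [U ->]]]]; apply: dtperm_sqr. Qed.

Lemma double_transposition1 : double_transposition 1%g = false.
Proof.
apply: contraFF (erefl false) => /double_transpositionP[a [b [c [d [U]]]]] /permP/(_ a).
have ab : a != b by split_uniq U.
by split_uniq U; rewrite /dtperm; eval_tperm => /eqP; rewrite (negPf ab).
Qed.

Definition commuting_pair (q : {perm T} * {perm T}) :=
  [&& double_transposition q.1, double_transposition q.2,
      double_transposition (q.1 * q.2)%g & (q.1 * q.2 == q.2 * q.1)%g].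

Lemma share_commuting_pair a b c d p q : uniq [:: p; q; a; b; c; d] ->
  commuting_pair (dtperm p q a b, dtperm p q c d).
Proof.
move=> U; have U' : uniq [:: p; q; c; d; a; b] by split_uniq U; distinct.
rewrite /commuting_pair /= (dtperm_share U) (dtperm_share U') (@dtpermCA a b c d).
  by split_uniq U; rewrite !dtperm_dt ?eqxx //; distinct.
by split_uniq U; distinct.
Qed.

Lemma klein_commuting_pair a b c d : uniq [:: a; b; c; d] ->
  commuting_pair (dtperm a b c d, dtperm a c b d).
Proof.
move=> U; have U' : uniq [:: a; c; b; d] by split_uniq U; distinct.
rewrite /commuting_pair /= (dtperm_klein U) (dtperm_klein U').
split_uniq U; rewrite !dtperm_dt; try by distinct.
by rewrite /dtperm (tpermC c b) eqxx.
Qed.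

Section Additive.
Variable F : {perm T} -> bool.
Hypothesis F_add : forall r, commuting_pair r -> F r.1 (+) F r.2 = F (r.1 * r.2)%g.

Let B a b c d := F (dtperm a b c d).

Let B_share a b c d p q : uniq [:: p; q; a; b; c; d] -> B p q a b (+) B p q c d = B a b c d.
Proof. by move=> U; rewrite /B -(dtperm_share U) -(F_add (share_commuting_pair U)). Qed.

Let B_klein a b c d : uniq [:: a; b; c; d] -> B a b c d (+) B a c b d = B a d b c.
Proof. by move=> U; rewrite /B -(dtperm_klein U) -(F_add (klein_commuting_pair U)). Qed.

Variables p q : T.

Let g a b := B p q a b.

Let gC a b : g a b = g b a.
Proof. by rewrite /g /B /dtperm (tpermC a b). Qed.

(** The edges [a b], [c d] and [p q] are disjoint, so [F] of the double transposition of the first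
two is [g a b (+) g c d]: the three pairs of opposite edges of a quadrangle give [g_quad]. *)
Let g_quad a b c d : uniq [:: p; q; a; b; c; d] ->
  (g a b (+) g c d) (+) (g a c (+) g b d) = g a d (+) g b c.
Proof.
move=> U; rewrite !B_share ?B_klein //; split_uniq U; distinct.
Qed.

(** Sum of [g_quad] for [a b c d] and for [a b c e]. *)
Let g_triple a b c d e : uniq [:: p; q; a; b; c; d; e] ->
  (g a d (+) g a e) (+) (g b d (+) g b e) = g c d (+) g c e.
Proof.
move=> U; have := @g_quad a b c d; have := @g_quad a b c e.
rewrite (gC b c) => /(_ _)h1 /(_ _)h2; move: h1 h2.
have -> : uniq [:: p; q; a; b; c; d] by split_uniq U; distinct.
have -> : uniq [:: p; q; a; b; c; e] by split_uniq U; distinct.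
move=> /(_ isT) h1 /(_ isT) h2; move: h1 h2.
by case: (g a b) (g c d) (g a c) (g b d) (g a d) (g c b) (g c e) (g b e) (g a e)
  => [] [] [] [] [] [] [] [] [].
Qed.

(** The function [v |-> g v d (+) g v e] sums to zero on any three of [a], [b], [c], [x].  Hence it
is constant on them, and three times its value is zero. *)
Let g_star a b c x d e : uniq [:: p; q; a; b; c; x; d; e] -> g a d = g a e.
Proof.
move=> U.
have h1 : _ := @g_triple a b c d e _; have h2 : _ := @g_triple a b x d e _.
have h3 : _ := @g_triple a c x d e _.
have U1 : uniq [:: p; q; a; b; c; d; e] by split_uniq U; distinct.
have U2 : uniq [:: p; q; a; b; x; d; e] by split_uniq U; distinct.
have U3 : uniq [:: p; q; a; c; x; d; e] by split_uniq U; distinct.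
move: (h1 U1) (h2 U2) (h3 U3).
by case: (g a d) (g a e) (g b d) (g b e) (g c d) (g c e) (g x d) (g x e) => [] [] [] [] [] [] [] [].
Qed.

(** By [g_star], [g] takes the same value on two edges with a common vertex, so
[g a b = g a c = g c d]. *)
Lemma additive_vanishes8 a b c d x y : uniq [:: p; q; a; b; c; d; x; y] ->
  F (dtperm a b c d) = false.
Proof.
move=> U; rewrite -/(B a b c d) -(@B_share a b c d p q); last by split_uniq U; distinct.
rewrite -!/(g _ _) (@g_star a d x y b c); last by split_uniq U; distinct.
rewrite gC (@g_star c b x y a d); last by split_uniq U; distinct.
exact: addbb.
Qed.

End Additive.

(** The argument uses eight points: the four moved ones, [p] and [q], and two more for [g_star]. *)
Lemma additive_vanishes (F : {perm T} -> bool) : (7 < #|T|)%N ->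
  (forall r, commuting_pair r -> F r.1 (+) F r.2 = F (r.1 * r.2)%g) ->
  forall s, double_transposition s -> F s = false.
Proof.
move=> T8 F_add s /double_transpositionP[a [b [c [d [U ->]]]]].
have : (3 < #|[predC [:: a; b; c; d]]|)%N.
  by rewrite -(ltn_add2l #|[:: a; b; c; d]|) cardC (card_uniqP U).
have := enum_uniq [predC [:: a; b; c; d]]; have := mem_enum [predC [:: a; b; c; d]].
rewrite cardE; case: (enum _) => [|p [|q [|x [|y r]]]] //= mem_r Ur _.
apply: (@additive_vanishes8 F F_add p q a b c d x y).
have np : p \notin [:: a; b; c; d] by rewrite -[_ \notin _]mem_r inE eqxx.
have nq : q \notin [:: a; b; c; d] by rewrite -[_ \notin _]mem_r !inE eqxx !orbT.
have nx : x \notin [:: a; b; c; d] by rewrite -[_ \notin _]mem_r !inE eqxx !orbT.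
have ny : y \notin [:: a; b; c; d] by rewrite -[_ \notin _]mem_r !inE eqxx !orbT.
split_uniq Ur; split_uniq U; split_uniq np; split_uniq nq; split_uniq nx; split_uniq ny.
by distinct.
Qed.

End DoubleTranspositions.

(** * The system of commuting double transpositions *)

Section DTSystem.
Variables (n : nat) (n8 : (7 < n.+1)%N).
Local Notation T := 'I_n.+1.

Definition dt_var := {s : {perm T} | double_transposition s}.
Definition dt_eqn := {r : {perm T} * {perm T} | commuting_pair r}.

(** Opaque proofs: otherwise comparing unknowns by conversion would evaluate
[double_transposition]. *)
Lemma dt_eqn_lt (r : dt_eqn) : double_transposition (val r).1.
Proof. by case/and4P: (valP r). Qed.

Lemma dt_eqn_md (r : dt_eqn) : double_transposition (val r).2.
Proof. by case/and4P: (valP r). Qed.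

Lemma dt_eqn_rt (r : dt_eqn) : double_transposition ((val r).1 * (val r).2)%g.
Proof. by case/and4P: (valP r). Qed.

Definition dt_lt (r : dt_eqn) : dt_var := Sub (val r).1 (dt_eqn_lt r).
Definition dt_md (r : dt_eqn) : dt_var := Sub (val r).2 (dt_eqn_md r).
Definition dt_rt (r : dt_eqn) : dt_var := Sub ((val r).1 * (val r).2)%g (dt_eqn_rt r).

Lemma dt_neq1 (s : dt_var) : val s != 1%g.
Proof. by apply: contraFneq (double_transposition1 T) => <-; apply: valP. Qed.

Lemma dt_lm r : dt_lt r != dt_md r.
Proof.
apply: contraNneq (dt_neq1 (dt_rt r)) => /(congr1 val) /= ->.
by rewrite (double_transposition_sqr (valP (dt_md r))).
Qed.

Lemma dt_lr r : dt_lt r != dt_rt r.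
Proof.
apply: contraNneq (dt_neq1 (dt_md r)) => /(congr1 val) /= e.
by rewrite -(inj_eq (mulgI (val r).1)) mulg1 -e.
Qed.

Lemma dt_mr r : dt_md r != dt_rt r.
Proof.
apply: contraNneq (dt_neq1 (dt_lt r)) => /(congr1 val) /= e.
by rewrite -(inj_eq (mulIg (val r).2)) mul1g -e.
Qed.

Definition dt_graph := system_graph dt_lt dt_md dt_rt.
Definition dt_color : dt_graph -> dt_var + dt_eqn := @system_color _ _ dt_lt dt_md dt_rt.

Lemma dt_only_zero_solution (f : dt_var -> bool) :
  (forall r, f (dt_lt r) (+) f (dt_md r) = f (dt_rt r)) -> f =1 xpred0.
Proof.
move=> f_add; pose F s := if insub s is Some i then f i else false.
have FE (i : dt_var) : F (val i) = f i by rewrite /F valK.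
clearbody F.
move=> i; rewrite -FE; apply: additive_vanishes (valP i); first by rewrite card_ord.
move=> r rP; pose r' : dt_eqn := Sub r rP.
by have := f_add r'; rewrite -(FE (dt_lt r')) -(FE (dt_md r')) -(FE (dt_rt r')).
Qed.

Variable R : realType.

Definition dt_op (i : dt_var) : matrix_cstar R n := perm_mx (val i).

Lemma dt_op_star i : star (dt_op i) = dt_op i.
Proof.
rewrite /dt_op /= /mstar map_perm_mx tr_perm_mx; congr perm_mx.
by apply/eqP; rewrite eq_invg_mul; apply/eqP/(double_transposition_sqr (valP i)).
Qed.

Lemma dt_opM i j : dt_op i * dt_op j = perm_mx (val i * val j)%g.
Proof. by rewrite perm_mxM. Qed.

Lemma dt_op_sqr i : dt_op i * dt_op i = 1.
Proof. by rewrite dt_opM (double_transposition_sqr (valP i)) perm_mx1. Qed.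

Lemma dt_op_lm r : dt_op (dt_lt r) * dt_op (dt_md r) = dt_op (dt_rt r).
Proof. exact: dt_opM. Qed.

Lemma dt_op_ml r : dt_op (dt_md r) * dt_op (dt_lt r) = dt_op (dt_rt r).
Proof.
by rewrite dt_opM /dt_op /=; case/and4P: (valP r) => _ _ _ /eqP ->.
Qed.

Lemma dt_op_noncomm : exists i j, dt_op i * dt_op j != dt_op j * dt_op i.
Proof.
pose o k : T := inord k.
have U : uniq (map o (iota 0 5)).
  rewrite map_inj_in_uniq ?iota_uniq // => i j; rewrite !mem_iota !add0n => i5 j5.
  by move/(congr1 val); rewrite /= !inordK // (leq_trans _ n8) // ltnW // ltnW // ltnW.
pose s := dtperm (o 0%N) (o 1%N) (o 2) (o 3).
pose t := dtperm (o 0%N) (o 2) (o 1%N) (o 4).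
rewrite /= in U; split_uniq U.
have sP : double_transposition s by apply: dtperm_dt; distinct.
have tP : double_transposition t by apply: dtperm_dt; distinct.
exists (Sub s sP), (Sub t tP); rewrite !dt_opM /=.
apply/eqP => /matrixP/(_ (o 0%N) (o 4)); rewrite !mxE.
have -> : (s * t)%g (o 0%N) = o 4 by rewrite /s /t /dtperm; eval_tperm.
have -> : (t * s)%g (o 0%N) = o 3 by rewrite /s /t /dtperm; eval_tperm.
have /negPf-> : o 3 != o 4 by distinct.
by rewrite eqxx => /eqP; rewrite oner_eq0.
Qed.

Definition dt_magic := @system_magic _ _ dt_lt dt_md dt_rt R (matrix_cstar R n) dt_op.

End DTSystem.

Theorem frucht_quantum_symmetry n (R : realType) (gT : finGroupType) : (7 < n.+1)%N ->
  graph_aut (frucht_graph gT (@dt_color n)) \isog [set: gT] /\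
  ~ Qut_eq_Aut R (frucht_graph gT (@dt_color n)).
Proof.
move=> n8; split.
  apply: frucht_graph_aut; first exact: system_color_surj.
  apply: (system_graph_asym (@dt_lm n) (@dt_lr n) (@dt_mr n)); exact: dt_only_zero_solution.
apply: (@quantum_symmetry_of_component R (matrix_cstar R n) _ _ _ (@dt_color n) (@dt_magic n R)).
- exact: (system_magic_rel (@dt_lm n) (@dt_lr n) (@dt_mr n) (@dt_op_star n R)
    (@dt_op_sqr n R) (@dt_op_lm n R) (@dt_op_ml n R)).
- exact: system_magic_color.
exact: system_magic_noncomm (dt_op_noncomm n8 R).
Qed.

Theorem theoremC (R : realType) (gT : finGroupType) (Gamma : {group gT}) :
  exists G1 G2 : sgraph,
    [/\ graph_aut G1 \isog Gamma,
        graph_aut G2 \isog Gamma,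
        Qut_eq_Aut R G1 &
        ~ Qut_eq_Aut R G2].
Proof.
have toGamma (G : sgraph) : graph_aut G \isog [set: subg_of Gamma] -> graph_aut G \isog Gamma.
  by move/isog_trans; apply; rewrite isog_sym isog_subg.
have [aut2 qut2] := @frucht_quantum_symmetry 7 R (subg_of Gamma) isT.
exists (frucht_graph (subg_of Gamma) void_color), (frucht_graph (subg_of Gamma) (@dt_color 7)).
split=> //; [| exact: toGamma | exact: frucht_no_quantum_symmetry].
by apply/toGamma/frucht_graph_aut => [|s _ _ _ []]; first exact: void_color_surj.
Qed.
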